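(* Let $d\ge 3$, $\varepsilon>0$ and $i>0$ be integers, let $n=d^2+2\varepsilon$, and let $m\ge 0$ be an integer. Then $$h(n;m)(t)=\max\left(0,\binom{t+2}{2}-n\binom{m+1}{2}\right)\quad\text{for each integer } t\ge 0$$ if $m$ falls into one of the following ranges: (a) $(d-1)(d-2)/(2\varepsilon)\le m<(d+2)(d+1)/(2\varepsilon)$; (b) $\left(i(d^2+\varepsilon)+(d-1)(d-2)/2\right)/\varepsilon\le m\le \left(id^2+d(d-1)/2\right)/\varepsilon$; (c) $\left(i(d^2+\varepsilon)+d(d-1)/2\right)/\varepsilon\le m\le \left(id^2+(d+1)d/2\right)/\varepsilon$; (d) $\left(i(d^2+\varepsilon)+(d+1)d/2\right)/\varepsilon\le m\le \left(id^2+d(d+3)/2\right)/\varepsilon$.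
   Context: Work over the complex numbers. For integers $n\ge1$, $m\ge0$, fix $n$ general points of $\mathbf{P}^2$ (''general'' means in a suitable nonempty Zariski open set of $n$-tuples, which may depend on $n$ and $m$). $I(n;m)\subset \mathbf{C}[\mathbf{P}^2]$ is the homogeneous ideal generated by all forms having multiplicity at least $m$ at each of the $n$ points, and $h(n;m)(t)=\dim_{\mathbf{C}} I(n;m)_t$ for integers $t\ge0$. *)

(* Defs.v *)
From HB Require Import structures.
From mathcomp Require Export all_boot all_order all_algebra.
From mathcomp Require Export boolp reals complex mpoly.

Set Implicit Arguments.
Unset Strict Implicit.
Unset Printing Implicit Defensive.

Import Order.TTheory GRing.Theory Num.Theory.

Local Open Scope ring_scope.

(* A point of P^2 is given by a nonzero vector of homogeneous coordinates, and
   an n-tuple of points by an n x 3 matrix with nonzero rows, so that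
   [p l : 'I_3 -> C] is a coordinate vector of the l-th point.  The notions
   below do not change when the rows are multiplied by nonzero scalars. *)
Definition is_config (C : numClosedFieldType) (n : nat) (p : 'M[C]_(n, 3)) :
  Prop := forall l, row l p != 0.

(* The n * 3 variables are the homogeneous coordinates of n points of P^2,
   numbered as in [mxvec]; the polynomial is homogeneous separately in the
   coordinates of each of the points. *)
Definition multihomogeneous (C : numClosedFieldType) (n : nat)
    (G : {mpoly C[n * 3]}) : Prop :=
  exists e : 'I_n -> nat, forall (u : 'X_{1..n * 3}) (l : 'I_n),
    u \in msupp G -> \sum_(j < 3) u (mxvec_index l j) = e l.

(* Zariski open subsets of (P^2)^n are the complements of the common zero loci
   of sets of multihomogeneous polynomials. *)
Definition zariski_open (C : numClosedFieldType) (n : nat)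
    (U : 'M[C]_(n, 3) -> Prop) : Prop :=
  exists S : {mpoly C[n * 3]} -> Prop,
    (forall G, S G -> multihomogeneous G) /\
    (forall p, is_config p ->
       (U p <-> exists2 G, S G & G.@[mxvec p 0] != 0)).

Definition for_general_points (C : numClosedFieldType) (n : nat)
    (P : 'M[C]_(n, 3) -> Prop) : Prop :=
  exists U : 'M[C]_(n, 3) -> Prop,
    [/\ zariski_open U,
        exists2 p, is_config p & U p
      & forall p, is_config p -> U p -> P p].

(* In characteristic 0 a form has multiplicity at least m at a point exactly
   when all its partial derivatives of order less than m vanish there. *)
Definition mult_ge (C : numClosedFieldType) (F : {mpoly C[3]}) (v : 'I_3 -> C)
    (m : nat) : Prop :=
  forall k : 'X_{1..3}, (mdeg k < m)%N -> (F^`M[k]).@[v] = 0.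

Definition ideal_generated (A : comNzRingType) (S : A -> Prop) (x : A) : Prop :=
  exists s : seq (A * A),
    (forall c, c \in s -> S c.2) /\ x = \sum_(c <- s) c.1 * c.2.

(* When p is a general configuration, this is I(n;m), and [hilb p m t] below is
   h(n;m)(t). *)
Definition fat_ideal (C : numClosedFieldType) (n : nat) (p : 'M[C]_(n, 3))
    (m : nat) : {mpoly C[3]} -> Prop :=
  ideal_generated (fun F =>
    (exists t, F \is t.-homog) /\ (forall l, mult_ge F (p l) m)).

Lemma vspace_of_submod (K : fieldType) (V : vectType K) (A : V -> Prop) :
  A 0 -> (forall a x y, A x -> A y -> A (a *: x + y)) ->
  exists U : {vspace V}, forall x, x \in U <-> A x.
Proof.
move=> A0 AL.
pose Q k := `[< exists U : {vspace V}, (forall x, x \in U -> A x) /\ \dim U = k >].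
have exQ : exists k, Q k.
  exists 0%N; apply/asboolP; exists 0%VS; split; last exact: dimv0.
  by move=> x; rewrite memv0 => /eqP ->.
have ubQ k : Q k -> (k <= \dim {:V})%N.
  by move=> /asboolP [U [_ <-]]; apply/dimvS/subvf.
have [k /asboolP [U [UA dimU]] kmax] := ex_maxnP exQ ubQ.
exists U => x; split; first exact: UA.
move=> Ax; apply: contrapT => /negP xU.
have UxA y : y \in (<[x]> + U)%VS -> A y.
  by case/memv_addP => _ /vlineP [a ->] [z zU ->]; apply: AL (UA _ zU).
have : (\dim (<[x]> + U)%VS <= k)%N.
  by apply: kmax; apply/asboolP; exists (<[x]> + U)%VS.
rewrite -dimU => /(conj (addvSr <[x]> U)) [sU leU].
have /eqP eqU : U == (<[x]> + U)%VS by rewrite eqEdim sU leU.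
by case/negP: xU; rewrite eqU; apply: (subvP (addvSl _ _)); exact: memv_line.
Qed.

Lemma ideal_generated_comb (A : comNzRingType) (S : A -> Prop) (a x y : A) :
  ideal_generated S x -> ideal_generated S y -> ideal_generated S (a * x + y).
Proof.
move=> [s [sS ->]] [s' [sS' ->]].
exists ([seq (a * c.1, c.2) | c <- s] ++ s'); split.
  move=> c; rewrite mem_cat => /orP [/mapP [b bs ->]|]; last exact: sS'.
  exact: sS bs.
rewrite big_cat big_map mulr_sumr /=; congr (_ + _).
by apply: eq_bigr => c _; rewrite mulrA.
Qed.

Lemma fat_ideal_part_subproof (C : numClosedFieldType) (n : nat)
    (p : 'M[C]_(n, 3)) (m t : nat) :
  exists U : {vspace dhomog 3 C t},
    forall F, F \in U <-> fat_ideal p m (val F).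
Proof.
apply: vspace_of_submod => [|a F G IF IG].
  by exists [::]; split=> //; rewrite big_nil raddf0.
by rewrite /= -mul_mpolyC; exact: ideal_generated_comb.
Qed.

(* The degree t part of the ideal, as a subspace of the space of forms of degree t. *)
Definition fat_ideal_part (C : numClosedFieldType) (n : nat)
    (p : 'M[C]_(n, 3)) (m t : nat) : {vspace dhomog 3 C t} :=
  sval (cid (fat_ideal_part_subproof p m t)).

Lemma fat_ideal_partP (C : numClosedFieldType) (n : nat) (p : 'M[C]_(n, 3))
    (m t : nat) (F : dhomog 3 C t) :
  F \in fat_ideal_part p m t <-> fat_ideal p m (val F).
Proof. exact: svalP (cid (fat_ideal_part_subproof p m t)) F. Qed.

Definition hilb (C : numClosedFieldType) (n : nat) (p : 'M[C]_(n, 3))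
    (m t : nat) : nat :=
  \dim (fat_ideal_part p m t).

(* Main.v *)
(* The points are specialized to [n] infinitely near points of a smooth curve
   germ which meets the curve [y = x^d] with multiplicity [r = d^2 + eps] at
   (1, 1).  For distinct points of the graph of [phi = x^d + (x - 1)^r], lying
   over the roots of [f], a polynomial written as [sum_b F_b(x) w^b] with
   [w = y - phi(x)] has multiplicity at least [m] at all of them iff [f^(m - b)]
   divides every [F_b]; when the roots of [f] come together at 1, this becomes
   the condition [v(F) >= n m] for the monomial valuation [v] with weights 1 on
   [x - 1] and [n] on [w].

   Put [u = y - x^d = w + (x - 1)^r], so that [v(u) = r].  The forms of degree
   [t] have the basis [x^a y^b u^k] with [a < d] and [a + b + k d <= t].
   Restricting to [u = 0] a form of valuation at least [Q] gives a polynomial in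
   [x] vanishing at 1 to an order at least [min_b (r b + max(0, Q - n b))],
   hence 0 if it has at most that many terms, by Descartes' rule; then [u] can
   be divided out, which lowers [Q] by [r] and [t] by [d].  By induction a span
   of basis elements with few enough terms in each level [k] contains no nonzero
   form of valuation at least [n m].  For [t = d (m + i) + s] all basis
   elements can be taken, and for the next degree [n m (m + 1) / 2] of
   them can be taken, where [s] is [d - 3], [d - 2] or [d - 1] according to the
   range of [m].  Both properties pass to general points by semicontinuity, the
   first one to lower degrees and the second one to higher degrees. *)

From HB Require Import structures.
Require Import Defs.
From mathcomp Require Import perm zify ring lra.

Set Implicit Arguments.
Unset Strict Implicit.
Unset Printing Implicit Defensive.

Import Order.TTheory GRing.Theory Num.Theory.

Local Open Scope ring_scope.

(** * Univariate and lacunary polynomials *)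

Lemma dvdp_exp_deriv (F : fieldType) (p g : {poly F}) (n : nat) :
  p ^+ n.+1 %| g -> p ^+ n %| g^`().
Proof.
case/dvdpP => q ->; rewrite derivM deriv_exp dvdp_add //.
  by rewrite dvdp_mull // exprS dvdp_mull.
by rewrite dvdp_mull // -mulrnAl /= dvdp_mull.
Qed.

(** If [X = 'X - s] and [g = q X^(n+1)], then [g'] is [(n+1) q X^n] modulo [X^(n+1)]; as [n+1] is
    invertible in characteristic 0, [q] has one more factor [X]. *)
Lemma dvdp_exp_XsubC_deriv (F : numFieldType) (g : {poly F}) (s : F) (n : nat) :
  root g s -> ('X - s%:P) ^+ n %| g^`() -> ('X - s%:P) ^+ n.+1 %| g.
Proof.
move=> gs; elim: n => [|n IHn] dvd_g'; first by rewrite expr1 dvdp_XsubCl.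
have /IHn/dvdpP[q Dg] : ('X - s%:P) ^+ n %| g^`().
  by apply: dvdp_trans dvd_g'; rewrite dvdp_exp2l.
have X0 : ('X - s%:P) ^+ n != 0 by rewrite expf_neq0 // polyXsubC_eq0.
have: ('X - s%:P) ^+ n * ('X - s%:P)
    %| q^`() * ('X - s%:P) ^+ n.+1 + n.+1%:R *: (q * ('X - s%:P) ^+ n).
  rewrite -exprSr; have := dvd_g'.
  by rewrite Dg derivM deriv_exp derivXsubC mul1r scaler_nat mulrnAr.
rewrite -exprSr dvdp_addr ?dvdp_mull // dvdpZr ?pnatr_eq0 //.
rewrite exprSr [q * _]mulrC dvdp_mul2l // => dvd_q.
by rewrite Dg [q * _]mulrC exprSr dvdp_mul2l // expf_neq0 ?polyXsubC_eq0.
Qed.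

(* The operator [x d/dx - e j0] kills one term and lowers the order of vanishing
   at 1 by at most one. *)
Lemma lacunary_eq0 (F : numFieldType) (T : eqType) (e : T -> nat) (s : seq T)
    (c : T -> F) :
  uniq s -> {in s &, injective e} ->
  ('X - 1%:P) ^+ size s %| \sum_(j <- s) c j *: 'X^(e j) ->
  {in s, forall j, c j = 0}.
Proof.
elim: s c => [//|j0 s IHs] c /= /andP[j0s us] inj_e dvd_g.
set g := \sum_(j <- _) _ in dvd_g.
have inj_s : {in s &, injective e}.
  by move=> i j si sj; apply: inj_e; rewrite inE ?si ?sj orbT.
have theta_g : 'X * g^`() - (e j0)%:R *: g
    = \sum_(j <- s) (((e j)%:R - (e j0)%:R) * c j) *: 'X^(e j).
  rewrite /g raddf_sum /= mulr_sumr scaler_sumr -sumrB big_cons.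
  rewrite [X in X + _](_ : _ = 0); last first.
    rewrite derivZ derivXn -scalerAr.
    case: (e j0) => [|k] /=; first by rewrite mulr0n mulr0 scaler0 scale0r
      subr0.
    by rewrite mulrnAr -exprS -scaler_nat scalerA mulrC -scalerA subrr.
  rewrite add0r; apply: eq_bigr => j _.
  rewrite derivZ derivXn -scalerAr mulrBl scalerBl -!scalerA.
  congr (_ - _).
  case: (e j) => [|k] /=; first by rewrite mulr0n mulr0 scaler0 scale0r.
  by rewrite mulrnAr -exprS -!scaler_nat !scalerA mulrC.
have c_s : {in s, forall j, c j = 0}.
  have /(IHs _ us inj_s) c_s : ('X - 1%:P) ^+ size s
      %| \sum_(j <- s) (((e j)%:R - (e j0)%:R) * c j) *: 'X^(e j).
    rewrite -theta_g dvdp_sub //; first by rewrite dvdp_mull // dvdp_exp_deriv.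
    by rewrite -mul_polyC dvdp_mull //; apply: dvdp_trans dvd_g;
      rewrite exprS dvdp_mull.
  move=> j sj; have /eqP := c_s j sj; rewrite mulf_eq0 subr_eq0 => /orP[|/eqP
    //].
  rewrite eqr_nat => /eqP/inj_e Ej; case/negP: j0s.
  by rewrite -Ej ?inE ?eqxx ?sj ?orbT.
move=> j; rewrite inE => /orP[/eqP -> {j}|/c_s //].
have : root g 1.
  by rewrite -dvdp_XsubCl; apply: dvdp_trans dvd_g; rewrite exprS dvdp_mulr.
rewrite /g big_cons big_seq big1 => [|j /c_s ->]; last by rewrite scale0r.
by rewrite addr0 /root hornerZ hornerXn expr1n mulr1 => /eqP.
Qed.

(** * The monomial valuation *)

(* [G] has valuation [Q] for the monomial valuation with weights 1 on ['X - 1]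
   and [n] on the outer variable. *)
Definition val_ge (F : fieldType) (n Q : nat) (G : {poly {poly F}}) : Prop :=
  forall b, ('X - 1%:P) ^+ (Q - n * b) %| G`_b.

(** The outer variable is [w], so this is [y = w + phi], and [upoly] is [u = y - x^d]. *)
Definition ypoly (F : fieldType) (d r : nat) : {poly {poly F}} :=
  'X + ('X^d + ('X - 1%:P) ^+ r)%:P.

Definition upoly (F : fieldType) (r : nat) : {poly {poly F}} :=
  'X + (('X - 1%:P) ^+ r)%:P.

(* The monomial [x^a y^b u^k] for [z = (k, (a, b))]. *)
Definition xyu (F : fieldType) (d r : nat) (z : nat * (nat * nat)) :
  {poly {poly F}} :=
  ('X^(z.2.1))%:P * ypoly F d r ^+ z.2.2 * upoly F r ^+ z.1.

(** The coefficient of [w^(b+1)] in [u G] is [G_b + (x - 1)^r G_(b+1)]. Going up in [b], the order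
    known for [G_b] is at least [Q - n (b+1)] because [r <= n], and then [(x - 1)^r] cancels. *)
Lemma val_ge_quot (F : fieldType) (n r Q : nat) (G : {poly {poly F}}) :
  (r <= n)%N -> val_ge n Q (upoly F r * G) -> val_ge n (Q - r) G.
Proof.
move=> le_rn vG; have X0 k : ('X - 1%:P : {poly F}) ^+ k != 0.
  by rewrite expf_neq0 // polyXsubC_eq0.
elim=> [|b IHb].
  have := vG 0%N; rewrite /upoly mulrDl coefD coefXM coefCM /= add0r muln0
    !subn0.
  case: (leqP r Q) => [le_rQ | /ltnW/eqP-> _]; last by rewrite expr0 dvd1p.
  by rewrite -{1}(subnKC le_rQ) exprD dvdp_mul2l.
have := vG b.+1; rewrite /upoly mulrDl coefD coefXM coefCM /=.
rewrite dvdp_addr; last by apply: dvdp_trans IHb; rewrite dvdp_exp2l //; lia.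
case: (leqP r (Q - n * b.+1)) => [le_rQ | lt_Qr _].
  by rewrite -{1}(subnKC le_rQ) exprD dvdp_mul2l // -subnDA addnC subnDA.
by rewrite (_ : _ - _ = 0)%N ?expr0 ?dvd1p //; lia.
Qed.

(** On [u = 0] one has [w = - (x - 1)^r], so the term of index [b] vanishes at 1 to order at least
    [(Q - n b) + r b]. *)
Lemma val_ge_restrict (F : fieldType) (n r Q N : nat) (G : {poly {poly F}}) :
  (forall a b, (Q <= a + n * b)%N -> (N <= a + r * b)%N) -> val_ge n Q G ->
  ('X - 1%:P) ^+ N %| G.[- ('X - 1%:P) ^+ r].
Proof.
move=> leN vG; rewrite horner_coef; elim/big_ind: _ => [|p q|b _].
- exact: dvdp0.
- exact: dvdp_add.
rewrite exprNn mulrCA dvdp_mull //.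
apply: dvdp_trans (dvdp_mul (vG b) (dvdpp _)).
rewrite -exprM -exprD dvdp_exp2l //; apply: leN; lia.
Qed.

Lemma xyu_restrict (F : fieldType) (d r k a b : nat) :
  (xyu F d r (k, (a, b))).[- ('X - 1%:P) ^+ r]
    = if k == 0%N then 'X^(a + d * b) else 0.
Proof.
rewrite /xyu /ypoly /upoly !hornerM !horner_exp !hornerD !hornerX.
rewrite !hornerC addNr addrC addrK /= -exprM -exprD expr0n.
by case: eqP; rewrite ?mulr1 ?mulr0.
Qed.

(* Restricting to the curve [u = 0] kills the terms of positive level, and what
   remains is a lacunary polynomial vanishing at 1 to an order which is at least
   its number of terms. *)
Lemma val_ge_xyu_eq0 (F : numFieldType) (d n r : nat) (K Q : nat)
    (s : seq (nat * (nat * nat))) (c : nat * (nat * nat) -> F) :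
  (r <= n)%N -> uniq s ->
  {in s, forall z, z.1 < K /\ z.2.1 < d}%N ->
  (forall k a b, k < K -> Q <= a + n * b + k * r ->
     count [pred z | z.1 == k] s <= a + r * b)%N ->
  val_ge n Q (\sum_(z <- s) (c z)%:P%:P * xyu F d r z) ->
  {in s, forall z, c z = 0}.
Proof.
move=> le_rn; elim: K Q s c => [|K IHK] Q s c us s_lt s_count vF.
  by move=> z /s_lt[].
pose s0 := [seq z <- s | z.1 == 0%N].
have c_s0 : {in s0, forall z, c z = 0}.
  apply: (lacunary_eq0 (e := fun z => z.2.1 + d * z.2.2)%N).
  - exact: filter_uniq.
  - move=> [k [a b]] [k' [a' b']]; rewrite !mem_filter /=.
    move=> /andP[/eqP-> /s_lt[_ /= lt_ad]] /andP[/eqP-> /s_lt[_ /= lt_ad']] Eab.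
    (* Since [a < d], Euclidean division recovers [a] and [b] from the exponent [a + d b]. *)
    have Eb : b = b'.
      have := congr1 (fun x => x %/ d)%N Eab; rewrite /= ![(_ + d * _)%N]addnC.
      by rewrite !(mulnC d) !divnMDl ?divn_small ?addn0 //; lia.
    by move: Eab; rewrite Eb => /addIn->.
  have -> : \sum_(z <- s0) c z *: 'X^(z.2.1 + d * z.2.2)
      = (\sum_(z <- s) (c z)%:P%:P * xyu F d r z).[- ('X - 1%:P) ^+ r].
    rewrite horner_sum big_filter big_mkcond /=; apply: eq_bigr => -[k [a b]] _.
    rewrite hornerM hornerC xyu_restrict /=.
    by case: eqP => _; rewrite ?mulr0 // mul_polyC.
  rewrite size_filter; apply: val_ge_restrict vF => a b leQ.
  by apply: s_count => //; rewrite mul0n addn0.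
(* With level 0 gone the sum is divisible by [u]; the quotient has its levels lowered by one and
   valuation [Q - r]. *)
pose s1 := [seq (z.1.-1, z.2) | z <- s & z.1 != 0%N].
pose c1 z := c (z.1.+1, z.2).
have c_s1 : {in s1, forall z, c1 z = 0}.
  apply: (IHK (Q - r)%N).
  - rewrite map_inj_in_uniq ?filter_uniq // => -[k x] [k' x'].
    rewrite !mem_filter /= => /andP[k0 _] /andP[k0' _] [Ek ->].
    by rewrite -(prednK (n := k)) ?lt0n // Ek prednK ?lt0n.
  - move=> z /mapP[[k x] + ->]; rewrite mem_filter /= => /andP[k0 /s_lt[/= ltk
      ltx]].
    by split=> //; lia.
  - move=> k a b lt_kK leQ; apply: leq_trans (s_count k.+1 a b _ _); try lia.
    rewrite count_map count_filter; apply/eq_leq/eq_count => -[k' x] /=; lia.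
  apply: val_ge_quot => //; rewrite mulr_sumr big_map big_filter /=.
  suff <- : \sum_(z <- s) (c z)%:P%:P * xyu F d r z
     = \sum_(z <- s | z.1 != 0%N)
        upoly F r * ((c1 (z.1.-1, z.2))%:P%:P * xyu F d r (z.1.-1, z.2)) by [].
  rewrite [RHS]big_mkcond !big_seq; apply: eq_bigr => -[k x] sz /=.
  case: eqP => [k0|] /=.
    by rewrite c_s0 ?mul0r // mem_filter /= k0 eqxx -k0.
  case: k sz => // k sz _; rewrite /c1 /xyu /= exprS; ring.
move=> [[|k] x] sz; first by rewrite c_s0 // mem_filter /=.
rewrite -[LHS]/(c1 (k, x)) c_s1 //; apply/mapP; exists (k.+1, x) => //.
by rewrite mem_filter.
Qed.

(** * Semicontinuity *)

Lemma row_free_minor (F : fieldType) (m n : nat) (A : 'M[F]_(m, n)) :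
  row_free A -> exists f : 'I_m -> 'I_n, \det (colsub f A) != 0.
Proof.
rewrite /row_free -mxrank_tr => fA; exists (fullrankfun fA).
by rewrite -det_tr trmx_mxsub -unitfE -unitmxE fullrowsub_unit.
Qed.

Lemma minor_ker0 (F : fieldType) (m n : nat) (A : 'M[F]_(m, n))
    (f : 'I_m -> 'I_n) (c : 'rV[F]_m) :
  \det (colsub f A) != 0 -> c *m A = 0 -> c = 0.
Proof.
move=> detA cA0; have uA : colsub f A \in unitmx by rewrite unitmxE unitfE.
rewrite -(mulmxK uA c) mulmx_colsub cA0 (_ : colsub f 0 = 0) ?mul0mx //.
by apply/rowP=> j; rewrite !mxE.
Qed.

(** A monic divisor keeps its degree under [h], so [h] maps the division with remainder to another
    one, and remainders are unique. *)
Lemma map_rmodp_monic (R S : nzRingType) (h : {rmorphism R -> S})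
    (p q : {poly R}) : q \is monic ->
  map_poly h (Pdiv.Ring.rmodp p q)
    = Pdiv.Ring.rmodp (map_poly h p) (map_poly h q).
Proof.
move=> mq; rewrite {2}(Pdiv.RingMonic.rdivp_eq mq p) rmorphD rmorphM /=.
rewrite Pdiv.RingMonic.rmodp_addl_mul_small //; first exact: monic_map.
rewrite [ltnRHS]size_map_poly_id0 ?(eqP mq) ?rmorph1 ?oner_neq0 //.
apply: leq_ltn_trans (size_poly _ _) _.
by rewrite Pdiv.Ring.ltn_rmodp monic_neq0.
Qed.

(* The remainders modulo the [q b] are polynomial in the parameter, so a minor
   which is nonzero at one value of it is nonzero outside the roots of [g]. *)
Lemma generic_dvd_indep (F : fieldType) (m N : nat)
    (q : 'I_m -> {poly {poly F}}) (P : 'I_N -> 'I_m -> {poly F}) (e0 : F) :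
  let indep (e : F) := forall c : 'rV[F]_N,
    (forall b, map_poly (horner_eval e) (q b) %| \sum_j c 0 j *: P j b) ->
    c = 0 in
  (forall b, q b \is monic) -> indep e0 ->
  exists2 g : {poly F}, g != 0 & forall e, g.[e] != 0 -> indep e.
Proof.
move=> indep mq ind0; pose L := \max_b size (q b).
(* Row [j] lists the coefficients of the remainders of all the [P j b]. At each [e] the left kernel
   consists of the combinations divisible by every specialized [q b]. *)
pose A := \matrix_(j < N) mxvec (\matrix_(b < m, i < L)
  (Pdiv.Ring.rmodp (map_poly polyC (P j b)) (q b))`_i).
have mqe e b : map_poly (horner_eval e) (q b) \is monic by exact: monic_map.
have AE e (c : 'rV_N) b i : (c *m map_mx (horner_eval e) A) 0 (mxvec_index b i)
    = ((\sum_j c 0 j *: P j b) %% map_poly (horner_eval e) (q b))`_i.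
  rewrite !mxE Pdiv.IdomainMonic.modpE // Pdiv.RingMonic.rmodp_sum //.
  rewrite coef_sum; apply: eq_bigr => j _.
  rewrite Pdiv.RingMonic.rmodpZ // coefZ !mxE mxvecE mxE.
  rewrite -[horner_eval e _]coef_map map_rmodp_monic // -map_poly_comp.
  by rewrite map_poly_id // => x _; rewrite /= /horner_eval hornerC.
have AP e (c : 'rV_N) : c *m map_mx (horner_eval e) A = 0 <->
    forall b, map_poly (horner_eval e) (q b) %| \sum_j c 0 j *: P j b.
  split=> [cA0 b | dvdc].
    apply/modp_eq0P/polyP => i; rewrite coef0.
    have [ltiL | leLi] := ltnP i L.
      by rewrite -(AE _ _ _ (Ordinal ltiL)) cA0 mxE.
    apply: nth_default; apply: leq_trans leLi.
    apply: leq_trans (leq_bigmax b).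
    have lt_size p : (size (p %% map_poly (horner_eval e) (q b))%R
        < size (map_poly (horner_eval e) (q b)))%N by rewrite ltn_modp
          monic_neq0.
    exact: leq_trans (ltnW (lt_size _)) (size_poly _ _).
  apply/rowP => k; case/mxvec_indexP: k => b i.
  by rewrite AE (modp_eq0P _ _ (dvdc b)) coef0 mxE.
have /row_free_minor[f nzf] : row_free (map_mx (horner_eval e0) A).
  by apply: inj_row_free => c /AP; apply: ind0.
exists (\det (colsub f A)).
  by apply: contraNneq nzf => d0; rewrite -map_mxsub det_map_mx d0 rmorph0.
move=> e nze c /AP; apply: (minor_ker0 (f := f)).
by rewrite -map_mxsub det_map_mx.
Qed.

(** * Multiplicities and the affine chart *)

Definition o1 : 'I_3 := @Ordinal 3 1 isT.
Definition o2 : 'I_3 := @Ordinal 3 2 isT.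

(* Over the chart [X_0 = 1] only the derivatives with respect to the coordinates
   1 and 2 matter. *)
Definition amon (a b : nat) : 'X_{1..3} := (U_(o1) *+ a + U_(o2) *+ b)%MM.

Fixpoint affm (C : comNzRingType) (F : {mpoly C[3]}) (v : 'I_3 -> C) (m : nat) :
    Prop :=
  if m is m'.+1 then
    [/\ F.@[v] = 0, affm F^`M(o1) v m' & affm F^`M(o2) v m']
  else True.

Lemma amonS1 (a b : nat) : amon a.+1 b = (U_(o1) + amon a b)%MM.
Proof. by apply/mnmP => i; rewrite !mnmDE !mulmnE; lia. Qed.

Lemma amonS2 (a b : nat) : amon a b.+1 = (U_(o2) + amon a b)%MM.
Proof. by apply/mnmP => i; rewrite !mnmDE !mulmnE; lia. Qed.

Lemma amon00 : amon 0 0 = 0%MM.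
Proof. by apply/mnmP => i; rewrite !mnmDE !mulmnE !muln0. Qed.

Lemma affmP (C : comNzRingType) (F : {mpoly C[3]}) (v : 'I_3 -> C) (m : nat) :
  affm F v m <-> forall a b, (a + b < m)%N -> (F^`M[amon a b]).@[v] = 0.
Proof.
elim: m F => [//|m IHm] F /=; split=> [[F0 /IHm F1 /IHm F2] [|a] b lt_abm|cF].
- case: b lt_abm => [|b] lt_abm; first by rewrite amon00 mderivm0m.
  by rewrite amonS2 mderivmDm mderivmU1m; apply: F2.
- by rewrite amonS1 mderivmDm mderivmU1m; apply: F1; lia.
split; first by have := cF 0%N 0%N isT; rewrite amon00 mderivm0m.
  apply/IHm => a b lt_abm; rewrite -mderivmU1m -mderivmDm -amonS1.
  by apply: cF; lia.
apply/IHm => a b lt_abm; rewrite -mderivmU1m -mderivmDm -amonS2.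
by apply: cF; lia.
Qed.

Lemma affmW (C : comNzRingType) (F : {mpoly C[3]}) (v : 'I_3 -> C) (m : nat) :
  affm F v m.+1 -> affm F v m.
Proof. by move=> /affmP cF; apply/affmP => a b /ltnW; apply: cF. Qed.

Lemma affm0 (C : comNzRingType) (v : 'I_3 -> C) (m : nat) : affm 0 v m.
Proof. by apply/affmP => a b _; rewrite linear0 meval0. Qed.

Lemma affmD (C : comNzRingType) (F G : {mpoly C[3]}) (v : 'I_3 -> C) (m : nat) :
  affm F v m -> affm G v m -> affm (F + G) v m.
Proof.
move=> /affmP cF /affmP cG; apply/affmP => a b lt_abm.
by rewrite linearD mevalD cF ?cG ?addr0.
Qed.

Lemma affmM (C : comNzRingType) (A F : {mpoly C[3]}) (v : 'I_3 -> C) (m : nat) :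
  affm F v m -> affm (A * F) v m.
Proof.
elim: m A F => [//|m IHm] A F cF; have := cF;
  have /affmW := cF => cF' /= [F0 F1 F2].
by split; rewrite ?mevalM ?F0 ?mulr0 // mderivM; apply: affmD; apply: IHm.
Qed.

Lemma mult_ge_affm (C : numClosedFieldType) (F : {mpoly C[3]}) (v : 'I_3 -> C)
    (m : nat) : mult_ge F v m -> affm F v m.
Proof.
move=> mF; apply/affmP => a b lt_abm; apply: mF.
by rewrite /amon mdegD !mdegMn !mdeg1 !mul1n.
Qed.

Lemma fat_ideal_affm (C : numClosedFieldType) (n : nat) (p : 'M[C]_(n, 3))
    (m : nat) (F : {mpoly C[3]}) (l : 'I_n) :
  fat_ideal p m F -> affm F (p l) m.
Proof.
case=> s [sP ->]; rewrite big_seq; elim/big_ind: _ => [|G H|c /sP[_ mc]].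
- exact: affm0.
- exact: affmD.
exact/affmM/mult_ge_affm.
Qed.

Lemma mpoly_euler (C : comNzRingType) (n t : nat) (F : {mpoly C[n]}) :
  F \is t.-homog -> \sum_i 'X_i * F^`M(i) = t%:R *: F.
Proof.
move=> /dhomogP hF; rewrite {2}[F]mpolyE scaler_sumr.
under eq_bigr => i _ do rewrite {1}[F]mpolyE linear_sum mulr_sumr.
rewrite exchange_big /= !big_seq; apply: eq_bigr => u /hF degu.
under eq_bigr => i _ do rewrite mderivZ mderivX -!scalerAr.
rewrite -scaler_sumr scalerA mulrC -scalerA -degu; congr (_ *: _).
rewrite /= mdegE natr_sum scaler_suml; apply: eq_bigr => i _.
have [->|ui0] := eqVneq (u i) 0%N; first by rewrite !scale0r.
by rewrite -mpolyXD addmC submK // lep1mP.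
Qed.

(** The weight is a scalar rather than a degree, so that it can drop below 0 without truncation. *)
Lemma euler_deriv (C : comNzRingType) (n : nat) (e : C) (F : {mpoly C[n]})
    (j : 'I_n) :
  \sum_i 'X_i * F^`M(i) = e *: F ->
  \sum_i 'X_i * F^`M(j)^`M(i) = (e - 1) *: F^`M(j).
Proof.
have subUU : (U_(j) - U_(j) = 0 :> 'X_{1..n})%MM.
  by apply/mnmP => k; rewrite mnmBE subnn mnm0E.
move=> /(congr1 (mderiv j)); rewrite mderivZ scalerBl scale1r => <-.
rewrite linear_sum /= (bigD1 j) //= [in RHS](bigD1 j) //=.
rewrite [in RHS](eq_bigr (fun i => 'X_i * F^`M(j)^`M(i))) => [|i ij];
  last first.
  rewrite mderivM mderivX mnm1E (negPf ij) scale0r mul0r add0r.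
  by rewrite mderiv_comm.
by rewrite mderivM mderivX mnm1E eqxx scale1r subUU mpolyX0; ring.
Qed.

(** The coordinate [X_0] is nonzero at [v] and constant for the derivatives along the coordinates 1
    and 2. *)
Lemma affm_X0 (C : idomainType) (F : {mpoly C[3]}) (v : 'I_3 -> C) (m : nat) :
  v ord0 != 0 -> affm ('X_ord0 * F) v m -> affm F v m.
Proof.
move=> v0; elim: m F => [//|m IHm] F /= [].
rewrite mevalM mevalXU => /eqP; rewrite mulf_eq0 (negPf v0) /= => /eqP F0.
by rewrite !mderivM !mderivX !mnm1E !scale0r !mul0r !add0r => /IHm F1 /IHm F2.
Qed.

(* By Euler's formula the derivative along the coordinate [X_0], which does not
   vanish at [v], is a combination of the two others and of [F]. *)
Lemma affm_mult_ge (C : numClosedFieldType) (e : C) (F : {mpoly C[3]})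
    (v : 'I_3 -> C) (m : nat) :
  v ord0 != 0 -> \sum_i 'X_i * F^`M(i) = e *: F -> affm F v m -> mult_ge F v m.
Proof.
move=> v0; elim: m e F => [//|m IHm] e F eF cF k.
have cF' := affmW cF.
have cdF i : affm F^`M(i) v m.
  case: cF => _ F1 F2; case: i => -[|[|[|//]]] lti.
  - rewrite (_ : Ordinal lti = ord0); last exact: val_inj.
    apply: affm_X0 v0 _.
    have -> : 'X_ord0 * F^`M(ord0)
        = e%:MP * F + ((-1)%:MP * 'X_o1 * F^`M(o1) + (-1)%:MP * 'X_o2 *
          F^`M(o2)).
      rewrite mul_mpolyC -eF !big_ord_recl big_ord0 addr0.
      rewrite (_ : lift ord0 ord0 = o1); last exact: val_inj.
      rewrite (_ : lift ord0 (lift ord0 ord0) = o2); last exact: val_inj.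
      rewrite !mpolyCN mpolyC1; ring.
    by apply: affmD; [|apply: affmD]; apply: affmM.
  - by rewrite (_ : Ordinal lti = o1) //; apply: val_inj.
  - by rewrite (_ : Ordinal lti = o2) //; apply: val_inj.
have [-> _|k0 ltk] := eqVneq k 0%MM; first by rewrite mderivm0m; case: cF.
have [i ki] : exists i, k i != 0%N.
  apply/existsP; apply: contraNT k0 => /existsPn k0; apply/eqP/mnmP => i.
  by rewrite mnm0E; apply/eqP; have := k0 i; rewrite negbK.
have Dk : k = (U_(i) + (k - U_(i)))%MM by rewrite addmC submK // lep1mP.
rewrite Dk mderivmDm mderivmU1m; apply: IHm (euler_deriv i eF) (cdF i) _ _.
by move: ltk; rewrite {1}Dk mdegD mdeg1.
Qed.

Lemma mpoly_ring_ind (R : comNzRingType) (n : nat) (P : {mpoly R[n]} -> Prop) :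
  (forall c, P c%:MP) -> (forall i, P 'X_i) ->
  (forall F G, P F -> P G -> P (F + G)) ->
  (forall F G, P F -> P G -> P (F * G)) ->
  forall F, P F.
Proof.
move=> PC PX PD PM F; rewrite [F]mpolyE.
elim/big_ind: _ => [||u _]; [by rewrite -mpolyC0 | exact: PD |].
rewrite -mul_mpolyC; apply: (PM); [exact: PC | rewrite mpolyXE_id].
elim/big_ind: _ => [||i _]; [by rewrite -mpolyC1 | exact: PM |].
by elim: (u i) => [|k IHk]; rewrite ?expr0 -?mpolyC1 // exprS; apply: (PM).
Qed.

(* The affine chart [X_0 = 1], [X_1 = x], [X_2 = phi x + w], as a polynomial in
   [w] over the polynomials in [x]. *)
Definition chart_var (F : comNzRingType) (phi : {poly F}) (i : 'I_3) :
    {poly {poly F}} :=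
  tnth [tuple 1; 'X%:P; 'X + phi%:P] i.

Definition chart (F : comNzRingType) (phi : {poly F}) :
    {mpoly F[3]} -> {poly {poly F}} :=
  mmap (polyC \o polyC) (chart_var phi).

HB.instance Definition _ (F : comNzRingType) (phi : {poly F}) :=
  GRing.RMorphism.on (chart phi).

Lemma chartC (F : comNzRingType) (phi : {poly F}) (c : F) :
  chart phi c%:MP = c%:P%:P.
Proof. exact: mmapC. Qed.

Lemma chartD (F : comNzRingType) (phi : {poly F}) :
  {morph chart phi : G H / G + H}.
Proof. exact: rmorphD. Qed.

Lemma chartM (F : comNzRingType) (phi : {poly F}) :
  {morph chart phi : G H / G * H}.
Proof. exact: rmorphM. Qed.

Lemma chartB (F : comNzRingType) (phi : {poly F}) :
  {morph chart phi : G H / G - H}.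
Proof. exact: rmorphB. Qed.

Lemma chartXn (F : comNzRingType) (phi : {poly F}) (k : nat) :
  {morph chart phi : G / G ^+ k}.
Proof. exact: rmorphXn. Qed.

Lemma chartX (F : comNzRingType) (phi : {poly F}) (i : 'I_3) :
  chart phi 'X_i = chart_var phi i.
Proof. by rewrite /chart mmapX mmap1U. Qed.

Lemma chart_w (F : comNzRingType) (phi : {poly F}) (G : {mpoly F[3]}) :
  (chart phi G)^`() = chart phi G^`M(o2).
Proof.
elim/mpoly_ring_ind: G => [c|i|G H IG IH|G H IG IH].
- by rewrite mderivC chartC derivC rmorph0.
- rewrite chartX mderivX mnm1E; case: i => -[|[|[|//]]] lti /=.
  + by rewrite scale0r rmorph0 (_ : chart_var _ _ = 1) // derivC.
  + by rewrite scale0r rmorph0 (_ : chart_var _ _ = 'X%:P) // derivC.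
  rewrite (_ : chart_var _ _ = 'X + phi%:P) // derivD derivX derivC addr0
    scale1r.
  rewrite (_ : (_ - _)%MM = 0%MM) ?mpolyX0 ?rmorph1 //.
  by apply/mnmP => k; rewrite mnmBE !mnm1E mnm0E; case: eqP.
- by rewrite mderivD !chartD derivD IG IH.
by rewrite mderivM chartD !chartM derivM IG IH.
Qed.

(** Chain rule with [w] fixed: [X_1 = x] has derivative 1 and [X_2 = phi x + w] has derivative
    [phi']. *)
Lemma chart_x (F : comNzRingType) (phi : {poly F}) (G : {mpoly F[3]}) (b : nat)
  :
  ((chart phi G)`_b)^`()
    = (chart phi G^`M(o1))`_b + phi^`() * (chart phi G^`M(o2))`_b.
Proof.
elim/mpoly_ring_ind: G b => [c|i|G H IG IH|G H IG IH] b.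
- rewrite !mderivC rmorph0 chartC coefC coef0 mulr0 addr0.
  by case: eqP; rewrite ?derivC ?linear0.
- rewrite chartX !mderivX !mnm1E; case: i => -[|[|[|//]]] lti /=.
  + rewrite !scale0r rmorph0 (_ : chart_var _ _ = 1) // coef1 coef0 mulr0 addr0.
    by case: eqP; rewrite ?derivC ?linear0.
  + rewrite scale0r scale1r rmorph0 (_ : chart_var _ _ = 'X%:P) // coef0 mulr0
      addr0.
    rewrite (_ : (_ - _)%MM = 0%MM) ?mpolyX0 ?rmorph1; last first.
      by apply/mnmP => k; rewrite mnmBE !mnm1E mnm0E; case: eqP.
    by rewrite coefC coef1; case: eqP; rewrite ?derivX ?linear0.
  rewrite scale0r scale1r rmorph0 (_ : chart_var _ _ = 'X + phi%:P) // coef0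
    add0r.
  rewrite (_ : (_ - _)%MM = 0%MM) ?mpolyX0 ?rmorph1; last first.
    by apply/mnmP => k; rewrite mnmBE !mnm1E mnm0E; case: eqP.
  rewrite coefD coefX coefC coef1; case: b => [|[|b]] /=.
  + by rewrite add0r mulr1.
  + by rewrite addr0 -[1]/(1%:P) derivC mulr0.
  by rewrite addr0 linear0 mulr0.
- by rewrite !mderivD !chartD !coefD derivD IG IH mulrDr addrACA.
rewrite 2!mderivM 2!chartD 5!chartM 2!coefD 5!coefM raddf_sum /= mulrDr
  !mulr_sumr.
rewrite -!big_split /=; apply: eq_bigr => j _.
have distr (R : comNzRingType) (f g1 g2 g h h1 h2 : R) :
  (g1 + f * g2) * h + g * (h1 + f * h2)
    = g1 * h + g * h1 + (f * (g2 * h) + f * (g * h2)) by ring.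
by rewrite derivM IG IH distr.
Qed.

Definition affine_pt (F : comNzRingType) (phi : {poly F}) (s : F) (i : 'I_3) :
  F :=
  tnth [tuple 1; s; phi.[s]] i.

Lemma chart_eval (F : comNzRingType) (phi : {poly F}) (s : F) (G : {mpoly
  F[3]}) :
  ((chart phi G)`_0).[s] = G.@[affine_pt phi s].
Proof.
rewrite -horner_coef0; elim/mpoly_ring_ind: G => [c|i|G H IG IH|G H IG IH].
- by rewrite mevalC chartC !hornerC.
- rewrite chartX mevalXU; case: i => -[|[|[|//]]] lti.
  + by rewrite (_ : chart_var _ _ = 1) // !hornerC.
  + by rewrite (_ : chart_var _ _ = 'X%:P) // hornerC hornerX.
  by rewrite (_ : chart_var _ _ = 'X + phi%:P) // hornerD hornerX hornerC add0r.
- by rewrite mevalD chartD !hornerD IG IH.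
by rewrite mevalM chartM !hornerM IG IH.
Qed.

(** Up to the factor [b + 1], the coefficient of [w^(b+1)] is that of [w^b] for the derivative along
    [X_2]. The constant coefficient vanishes at [s], and its derivative is controlled by the chain
    rule and induction. *)
Lemma affm_dvd (F : numFieldType) (phi : {poly F}) (s : F) (m b : nat)
    (G : {mpoly F[3]}) :
  affm G (affine_pt phi s) m -> ('X - s%:P) ^+ (m - b) %| (chart phi G)`_b.
Proof.
elim: m G b => [|m IHm] G b; first by rewrite sub0n expr0 dvd1p.
case=> G0 /IHm G1 /IHm G2; case: b => [|b].
  rewrite subn0; apply: dvdp_exp_XsubC_deriv.
    by rewrite /root chart_eval G0.
  rewrite chart_x dvdp_add ?dvdp_mull //.
    by have := G1 0%N; rewrite subn0.
  by have := G2 0%N; rewrite subn0.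
have := G2 b; rewrite -chart_w coef_deriv subSS -scaler_nat dvdpZr //.
by rewrite pnatr_eq0.
Qed.

(* The distinct points 1, 1 + e, 1 + 2 e, ... come together when [e = 0]. *)
Definition sections (F : comNzRingType) (n : nat) (e : F) : {poly F} :=
  \prod_(l < n) ('X - (1 + e *+ l)%:P).

(** For [e != 0] the roots [1 + e l] are distinct in characteristic 0, so the factors are
    coprime. *)
Lemma sections_dvd (F : numFieldType) (n k : nat) (e : F) (g : {poly F}) :
  e != 0 ->
  (forall l : 'I_n, ('X - (1 + e *+ l)%:P) ^+ k %| g) -> sections n e ^+ k %| g.
Proof.
move=> e0; rewrite /sections; elim: n => [|n IHn] dvd_g.
  by rewrite big_ord0 expr1n dvd1p.
rewrite big_ord_recr exprMn Gauss_dvdp; last first.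
  rewrite coprimep_expl // coprimep_expr // coprimep_XsubC /root horner_prod.
  apply/prodf_neq0 => l _; rewrite hornerXsubC opprD addrACA subrr add0r.
  by rewrite subr_eq0 -[e *+ n]mulr_natr -[e *+ l]mulr_natr (inj_eq (mulfI e0))
    eqr_nat neq_ltn ltn_ord orbT.
apply/andP; split; first by apply: IHn => l; apply: (dvd_g (widen_ord _ l)).
exact: (dvd_g ord_max).
Qed.

(** * The specialized points *)

(* The homogenization of [xyu d r z]. *)
Definition curve_form (F : comNzRingType) (d t : nat) (z : nat * (nat * nat)) :
    {mpoly F[3]} :=
  'X_o1 ^+ z.2.1 * 'X_o2 ^+ z.2.2
    * ('X_o2 * 'X_ord0 ^+ d.-1 - 'X_o1 ^+ d) ^+ z.1
    * 'X_ord0 ^+ (t - (z.2.1 + z.2.2 + z.1 * d)).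

Lemma mpolyX_homog1 (F : comNzRingType) (n k : nat) (i : 'I_n) :
  ('X_i ^+ k : {mpoly F[n]}) \is k.-homog.
Proof. by rewrite -[k in k.-homog]mul1n dhomogMn // dhomogX /= mdeg1. Qed.

Lemma curve_form_homog (F : comNzRingType) (d t : nat) (z : nat * (nat * nat)) :
  (0 < d)%N -> (z.2.1 + z.2.2 + z.1 * d <= t)%N ->
  curve_form F d t z \is t.-homog.
Proof.
move=> d0 le_zt; have u_homog :
    ('X_o2 * 'X_ord0 ^+ d.-1 - 'X_o1 ^+ d : {mpoly F[3]}) \is d.-homog.
  apply: rpredB; last exact: mpolyX_homog1.
  have := dhomogM (mpolyX_homog1 F 1 o2) (mpolyX_homog1 F d.-1 ord0).
  by rewrite add1n prednK.
have := dhomogM (dhomogM (dhomogM (mpolyX_homog1 F z.2.1 o1)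
  (mpolyX_homog1 F z.2.2 o2)) (dhomogMn z.1 u_homog))
  (mpolyX_homog1 F (t - (z.2.1 + z.2.2 + z.1 * d)) ord0).
by rewrite (mulnC d) subnKC.
Qed.

Definition curve_graph (F : comNzRingType) (d r : nat) : {poly F} :=
  'X^d + ('X - 1%:P) ^+ r.

Lemma chart_curve_form (F : fieldType) (d r t : nat) (z : nat * (nat * nat)) :
  chart (curve_graph F d r) (curve_form F d t z) = xyu F d r z.
Proof.
rewrite /curve_form !chartM !chartXn chartB chartM !chartXn !chartX.
rewrite (_ : chart_var _ ord0 = 1) // (_ : chart_var _ o1 = 'X%:P) //.
rewrite (_ : chart_var _ o2 = ypoly F d r) // !expr1n !mulr1 /xyu.
congr (_ * _); first by rewrite rmorphXn.
by rewrite /ypoly /upoly rmorphD addrA rmorphXn addrAC addrK.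
Qed.

Definition config (F : comNzRingType) (phi : {poly F}) (n : nat) (e : F) :
    'M[F]_(n, 3) :=
  \matrix_(l < n, i < 3) affine_pt phi (1 + e *+ l) i.

(** Independence of the [w j] modulo the forms vanishing to order [m] at all the points. *)
Definition indep_mult (F : comNzRingType) (n N m : nat) (p : 'M[F]_(n, 3))
    (w : 'I_N -> {mpoly F[3]}) : Prop :=
  forall c : 'rV[F]_N,
    (forall l, affm (\sum_j c 0 j *: w j) (p l) m) -> c = 0.

Lemma map_sections (F : comNzRingType) (n : nat) (e : F) :
  map_poly (horner_eval e) (sections n 'X) = sections n e.
Proof.
rewrite rmorph_prod; apply: eq_bigr => l _.
rewrite rmorphB /= map_polyX map_polyC /= /horner_eval.
by rewrite hornerD hornerMn hornerX -[1]/(1%:P) hornerC.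
Qed.

(** At [e = 0] divisibility by the [sections n e ^+ (m - b)] is [val_ge n (n * m)], and
    [val_ge_xyu_eq0] applies. [generic_dvd_indep] extends this to all [e] outside the roots of [g];
    for [e != 0] vanishing at the points implies the divisibility. *)
Lemma config_indep (F : numFieldType) (d n r m t K : nat)
    (s : seq (nat * (nat * nat))) :
  (r <= n)%N -> uniq s ->
  {in s, forall z, z.1 < K /\ z.2.1 < d}%N ->
  (forall k a b, k < K -> n * m <= a + n * b + k * r ->
     count [pred z | z.1 == k] s <= a + r * b)%N ->
  exists2 g : {poly F}, g != 0 & forall e, e != 0 -> g.[e] != 0 ->
    indep_mult m (config (curve_graph F d r) n e)
      (fun j => curve_form F d t (tnth (in_tuple s) j)).
Proof.
move=> le_rn us s_lt s_count; pose z j := tnth (in_tuple s) j.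
pose phi := curve_graph F d r.
pose q (b : 'I_m) : {poly {poly F}} := sections n 'X ^+ (m - b).
pose P j (b : 'I_m) := (chart phi (curve_form F d t (z j)))`_b.
have qE e b : map_poly (horner_eval e) (q b) = sections n e ^+ (m - b).
  by rewrite rmorphXn /= map_sections.
have mq b : q b \is monic.
  by rewrite monic_exp // monic_prod // => l _; rewrite monicXsubC.
have PE (c : 'rV_(size s)) b : \sum_j c 0 j *: P j b
    = (chart phi (\sum_j c 0 j *: curve_form F d t (z j)))`_b.
  rewrite rmorph_sum coef_sum; apply: eq_bigr => j _.
  by rewrite /= -mul_mpolyC chartM chartC coefCM mul_polyC.
have [|g g0 indep_g] := generic_dvd_indep (e0 := 0) (P := P) mq.
  move=> c dvd_c; pose c' x := nth 0 [seq c 0 j | j <- enum 'I_(size s)] (index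
    x s).
  have c'E j : c' (z j) = c 0 j.
    rewrite /c' /z (tnth_nth (z j)) /= index_uniq //.
    by rewrite (nth_map j) ?size_enum_ord // nth_ord_enum.
  have c'0 : {in s, forall x, c' x = 0}.
    apply: (val_ge_xyu_eq0 le_rn us s_lt s_count) => b.
    have [le_mb | lt_bm] := leqP m b.
      have /eqP -> : (n * m - n * b == 0)%N by rewrite subn_eq0 leq_mul2l le_mb
        orbT.
      by rewrite expr0 dvd1p.
    have := dvd_c (Ordinal lt_bm); rewrite qE PE /=.
    rewrite (_ : sections n 0 = ('X - 1%:P) ^+ n); last first.
      rewrite /sections (eq_bigr (fun _ => 'X - 1%:P)) ?prodr_const ?card_ord
        //.
      by move=> l _; rewrite mul0rn addr0.
    rewrite -exprM mulnBr.
    suff -> : \sum_(x <- s) (c' x)%:P%:P * xyu F d r x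
        = chart phi (\sum_j c 0 j *: curve_form F d t (z j)) by [].
    rewrite rmorph_sum big_tnth /=; apply: eq_bigr => j _.
    by rewrite -mul_mpolyC chartM chartC chart_curve_form -c'E.
  by apply/rowP => j; rewrite -c'E mxE c'0 // mem_tnth.
exists g => // e e0 ge0 c cA; apply: (indep_g e) => // b.
rewrite qE PE; apply: sections_dvd => // l; apply: affm_dvd.
rewrite (_ : affine_pt phi _ = config phi n e l) //.
by apply/funext => i; rewrite mxE.
Qed.

(** * Open conditions on the points *)

Definition multidegree (C : comNzRingType) (n : nat) (e : 'I_n -> nat)
    (G : {mpoly C[n * 3]}) : Prop :=
  forall (u : 'X_{1..n * 3}) (l : 'I_n),
    u \in msupp G -> (\sum_(j < 3) u (mxvec_index l j))%N = e l.

Lemma multidegree0 (C : comNzRingType) (n : nat) (e : 'I_n -> nat) :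
  multidegree e (0 : {mpoly C[n * 3]}).
Proof. by move=> u l; rewrite msupp0. Qed.

Lemma multidegree1 (C : comNzRingType) (n : nat) :
  multidegree (fun=> 0%N) (1 : {mpoly C[n * 3]}).
Proof.
by move=> u l; rewrite msupp1 inE => /eqP ->; rewrite big1 // => j _;
  rewrite mnm0E.
Qed.

Lemma multidegreeD (C : comNzRingType) (n : nat) (e : 'I_n -> nat)
    (G H : {mpoly C[n * 3]}) :
  multidegree e G -> multidegree e H -> multidegree e (G + H).
Proof.
move=> mG mH u l /msuppD_le; rewrite mem_cat => /orP[]; [exact: mG | exact: mH].
Qed.

Lemma multidegreeM (C : comNzRingType) (n : nat) (e f : 'I_n -> nat)
    (G H : {mpoly C[n * 3]}) :
  multidegree e G -> multidegree f H ->
  multidegree (fun l => e l + f l)%N (G * H).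
Proof.
move=> mG mH u l /msuppM_le/allpairsP[[u1 u2] /= [/mG Eu1 /mH Eu2 ->]].
by rewrite -Eu1 -Eu2 -big_split; apply: eq_bigr => j _; rewrite mnmDE.
Qed.

Lemma eq_multidegree (C : comNzRingType) (n : nat) (e f : 'I_n -> nat)
    (G : {mpoly C[n * 3]}) : multidegree e G -> e =1 f -> multidegree f G.
Proof. by move=> mG ef u l /mG ->. Qed.

Lemma multidegreeZ (C : comNzRingType) (n : nat) (e : 'I_n -> nat) (c : C)
    (G : {mpoly C[n * 3]}) : multidegree e G -> multidegree e (c *: G).
Proof. by move=> mG u l /msuppZ_le; apply: mG. Qed.

Lemma multidegree_sum (C : comNzRingType) (n : nat) (e : 'I_n -> nat)
    (I : Type) (s : seq I) (P : pred I) (G : I -> {mpoly C[n * 3]}) :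
  (forall i, P i -> multidegree e (G i)) ->
  multidegree e (\sum_(i <- s | P i) G i).
Proof.
by move=> mG; elim/big_ind: _ => //; [exact: multidegree0 | move=> *;
  exact: multidegreeD].
Qed.

Lemma multidegree_prod (C : comNzRingType) (n : nat)
    (I : Type) (s : seq I) (e : I -> 'I_n -> nat) (G : I -> {mpoly C[n * 3]}) :
  (forall i, multidegree (e i) (G i)) ->
  multidegree (fun l => \sum_(i <- s) e i l)%N (\prod_(i <- s) G i).
Proof.
move=> mG; elim: s => [|i s IHs].
  rewrite big_nil; apply: (eq_multidegree (@multidegree1 C n)) => l.
  by rewrite big_nil.
rewrite big_cons; apply: (eq_multidegree (multidegreeM (mG i) IHs)) => l.
by rewrite big_cons.
Qed.

Lemma multidegreeXn (C : comNzRingType) (n k : nat) (e : 'I_n -> nat)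
    (G : {mpoly C[n * 3]}) :
  multidegree e G -> multidegree (fun l => k * e l)%N (G ^+ k).
Proof.
move=> mG; elim: k => [|k IHk]; first exact: multidegree1.
by rewrite exprS; apply: (eq_multidegree (multidegreeM mG IHk)).
Qed.

(** The degree of an entry depends on its column only, so all terms of the Leibniz expansion have
    the same multidegree. *)
Lemma multidegree_det (C : comNzRingType) (n N : nat) (e : 'I_N -> 'I_n -> nat)
    (A : 'M[{mpoly C[n * 3]}]_N) :
  (forall i j, multidegree (e j) (A i j)) ->
  multidegree (fun l => \sum_j e j l)%N (\det A).
Proof.
move=> mA; apply: multidegree_sum => s _.
have mP : multidegree (fun l => \sum_j e j l)%N (\prod_i A i (s i)).
  apply: (eq_multidegree (@multidegree_prod C n _ (index_enum 'I_N)
    (fun i => e (s i)) (fun i => A i (s i)) (fun i => mA i (s i)))) => l.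
  by rewrite [RHS](reindex_inj (@perm_inj _ s)).
by rewrite mulr_sign; case: ifP => // _; rewrite -scaleN1r; apply: multidegreeZ.
Qed.

Lemma mxvec_index_eq (m n : nat) (i i' : 'I_m) (j j' : 'I_n) :
  (mxvec_index i j == mxvec_index i' j') = (i == i') && (j == j').
Proof.
by rewrite /mxvec_index (inj_eq (@cast_ord_inj _ _ _)) (inj_eq enum_rank_inj).
Qed.

(* The coordinates of the [l]-th point are the variables of the [l]-th block. *)
Definition at_point (C : comNzRingType) (n : nat) (l : 'I_n) (F : {mpoly C[3]})
  :
    {mpoly C[n * 3]} :=
  F \mPo [tuple 'X_(mxvec_index l j) | j < 3].

Lemma at_point_eval (C : comNzRingType) (n : nat) (l : 'I_n) (F : {mpoly C[3]})
    (p : 'M[C]_(n, 3)) :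
  (at_point l F).@[mxvec p 0] = F.@[p l].
Proof.
rewrite comp_mpoly_meval; apply: meval_eq => j.
by rewrite tnth_mktuple mevalXU mxvecE.
Qed.

Lemma at_point_multidegree (C : comNzRingType) (n t : nat) (l : 'I_n)
    (F : {mpoly C[3]}) : F \is t.-homog ->
  multidegree (fun l' => if l' == l then t else 0)%N (at_point l F).
Proof.
move=> /dhomogP hF; rewrite /at_point comp_mpolyE big_seq.
apply: multidegree_sum => u /hF <-; apply: multidegreeZ.
have mX j : multidegree (fun l' => (l' == l) : nat)
    ('X_(mxvec_index l j) : {mpoly C[n * 3]}).
  move=> v l'; rewrite msuppX inE => /eqP ->.
  have [->|l'l] := eqVneq l' l.
    rewrite (bigD1 j) //= mnm1E eqxx big1 // => k kj; rewrite mnm1E.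
    by rewrite mxvec_index_eq eqxx eq_sym (negPf kj).
  by rewrite big1 // => k _; rewrite mnm1E mxvec_index_eq eq_sym (negPf l'l).
pose e (j : 'I_3) (l' : 'I_n) := (u j * (l' == l))%N.
have mXu j : multidegree (e j)
    (tnth [tuple 'X_(mxvec_index l k) | k < 3] j ^+ u j : {mpoly C[n * 3]}).
  by rewrite tnth_mktuple; apply: multidegreeXn.
apply: (eq_multidegree (@multidegree_prod C n _ (index_enum 'I_3) e _ mXu)) =>
  l'.
rewrite -big_distrl /= mdegE; case: eqP => _; last by rewrite muln0.
by rewrite muln1.
Qed.

(** The truncation is harmless: the derivative is 0 when its order exceeds [t]. *)
Lemma mderivm_homog (R : comNzRingType) (n t : nat) (k : 'X_{1..n})
    (F : {mpoly R[n]}) : F \is t.-homog -> F^`M[k] \is (t - mdeg k).-homog.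
Proof.
move=> /dhomogP hF; apply/dhomogP => u; rewrite mcoeff_msupp mcoeff_mderivm.
move=> Fu; have /hF /= <- : (k + u)%MM \in msupp F.
  by rewrite mcoeff_msupp; apply: contraNneq Fu => ->; rewrite mul0rn.
by rewrite mdegD addKn.
Qed.

Definition jets (m : nat) : seq (nat * nat) :=
  [seq (a, b) | a <- iota 0 m, b <- iota 0 (m - a)].

Lemma sum_ord_sub (m : nat) : (\sum_(a < m) (m - a) = 'C(m + 1, 2))%N.
Proof.
elim: m => [|m IHm]; first by rewrite big_ord0.
rewrite big_ord_recl subn0 /= (eq_bigr (fun a : 'I_m => m - a)%N) // IHm.
by rewrite !addn1 [in RHS]binS bin1 addnC.
Qed.

Lemma size_jets (m : nat) : size (jets m) = 'C(m + 1, 2).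
Proof.
rewrite size_allpairs_dep sumnE big_map -sum_ord_sub -(big_mkord xpredT).
by rewrite /index_iota subn0; apply: eq_bigr => a _; rewrite size_iota.
Qed.

Lemma mem_jets (m a b : nat) : ((a, b) \in jets m) = (a + b < m)%N.
Proof.
apply/allpairsPdep/idP => [[x [y [+ + [-> ->]]]]|lt_abm].
  by rewrite !mem_iota; lia.
by exists a, b; rewrite !mem_iota; split=> //; lia.
Qed.

Definition jet (m : nat) (i : 'I_(size (jets m))) : nat * nat :=
  tnth (in_tuple (jets m)) i.

Lemma affm_jets (C : comNzRingType) (F : {mpoly C[3]}) (v : 'I_3 -> C) (m :
  nat) :
  affm F v m <-> forall i, (F^`M[amon (jet (m := m) i).1 (jet i).2]).@[v] = 0.
Proof.
rewrite affmP; split=> [cF i|cF a b]; first apply: cF.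
  rewrite -mem_jets -surjective_pairing; exact: mem_tnth.
rewrite -mem_jets => abJ; have lt_i : (index (a, b) (jets m) < size (jets m))%N.
  by rewrite index_mem.
have := cF (Ordinal lt_i); rewrite /jet (tnth_nth (0, 0)%N) /=.
by rewrite nth_index.
Qed.

(** The combinations satisfying the conditions are the left kernel of the matrix of jets of the
    [w j]. Independence at [p0] makes its rows free, which bounds [N] by the number of columns and
    yields a nonzero maximal minor, namely [G]. *)
Lemma indep_open (C : fieldType) (n N m t : nat) (w : 'I_N -> {mpoly C[3]})
    (p0 : 'M[C]_(n, 3)) :
  (forall j, w j \is t.-homog) -> indep_mult m p0 w ->
  (N <= n * 'C(m + 1, 2))%N /\
  exists e G, [/\ multidegree e G, G.@[mxvec p0 0] != 0
    & forall p : 'M[C]_(n, 3), G.@[mxvec p 0] != 0 -> indep_mult m p w].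
Proof.
move=> hw ind0; pose q := size (jets m).
pose A (p : 'M[C]_(n, 3)) := \matrix_(j < N) mxvec (\matrix_(l < n, i < q)
  ((w j)^`M[amon (jet (m := m) i).1 (jet i).2]).@[p l]).
have AP p (c : 'rV[C]_N) :
    c *m A p = 0 <-> forall l, affm (\sum_j c 0 j *: w j) (p l) m.
  have AE l i : (c *m A p) 0 (mxvec_index l i)
      = ((\sum_j c 0 j *: w j)^`M[amon (jet (m := m) i).1 (jet i).2]).@[p l].
    rewrite !mxE !raddf_sum /=; apply: eq_bigr => j _.
    by rewrite mderivmZ mevalZ !mxE mxvecE mxE.
  split=> [cA0 l | cF].
    by apply/affm_jets => i; rewrite -AE cA0 mxE.
  apply/rowP => k; case/mxvec_indexP: k => l i.
  by rewrite AE mxE; have /affm_jets := cF l; apply.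
have /row_free_minor[f nzf] : row_free (A p0).
  by apply: inj_row_free => c /AP; apply: ind0.
split.
  have : row_free (A p0) by apply: inj_row_free => c /AP; apply: ind0.
  rewrite -row_leq_rank => /leq_trans; apply.
  by apply: leq_trans (rank_leq_col _) _; rewrite /q size_jets.
pose B := \matrix_(j < N) mxvec (\matrix_(l < n, i < q)
  at_point l (w j)^`M[amon (jet (m := m) i).1 (jet i).2]).
have BE p : map_mx (meval (mxvec p 0)) B = A p.
  apply/matrixP => j k; case/mxvec_indexP: k => l i.
  by rewrite !mxE !mxvecE !mxE at_point_eval.
(* The degree of column [k] in the coordinates of point [l']; it is common to all rows since the
   [w j] have the same degree. *)
pose E k l' := mxvec (\matrix_(l < n, i < q)
  if l' == l then (t - mdeg (amon (jet (m := m) i).1 (jet i).2))%N else 0%N) 0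
    k.
have GE p : (\det (colsub f B)).@[mxvec p 0] = \det (colsub f (A p)).
  by rewrite -BE -map_mxsub det_map_mx.
exists (fun l => \sum_j E (f j) l)%N, (\det (colsub f B)); split.
- apply: (@multidegree_det C n N (fun j => E (f j))) => i j.
  rewrite !mxE; case/mxvec_indexP: (f j) => l k; rewrite mxvecE mxE.
  apply: (eq_multidegree (@at_point_multidegree C n _ l _ (mderivm_homog _ (hw
    i)))).
  by move=> l'; rewrite /E mxvecE mxE.
- by rewrite GE.
by move=> p nzp c /AP; apply: (minor_ker0 (f := f)); rewrite -GE.
Qed.

(** Multiplying by powers of [X_0], which is nonzero at the points, does not change the orders of
    vanishing. *)
Lemma indep_mulX0 (C : idomainType) (n N m k : nat) (w : 'I_N -> {mpoly C[3]})
    (p : 'M[C]_(n, 3)) :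
  (forall l, p l ord0 != 0) -> indep_mult m p w ->
  indep_mult m p (fun j => 'X_ord0 ^+ k * w j).
Proof.
move=> p0 indw c cA; apply: indw => l; have := cA l.
have -> : \sum_j c 0 j *: ('X_ord0 ^+ k * w j)
    = 'X_ord0 ^+ k * \sum_j c 0 j *: w j.
  by rewrite mulr_sumr; apply: eq_bigr => j _; rewrite scalerAr.
elim: k {cA} => [|k IHk]; first by rewrite expr0 mul1r.
by rewrite exprS -mulrA => /(affm_X0 (p0 l)).
Qed.

(** * Bounds on the Hilbert function *)

Lemma dim_forms (C : fieldType) (t : nat) :
  \dim {: dhomog 3 C t} = 'C(t + 2, 2).
Proof. by rewrite dimvf /dim /= -bin_sub ?leq_addr // addKn. Qed.

(** The [w j] span a space of dimension [N] which meets the ideal only in 0. *)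
Lemma hilb_upper (C : numClosedFieldType) (n N m t : nat) (p : 'M[C]_(n, 3))
    (w : 'I_N -> {mpoly C[3]}) :
  (forall j, w j \is t.-homog) -> indep_mult m p w ->
  (hilb p m t + N <= 'C(t + 2, 2))%N.
Proof.
move=> hw indw; pose v j : dhomog 3 C t := DHomog (hw j).
pose X := [tuple v j | j < N].
have comb (c : 'I_N -> C) : \sum_(j < N) c j *: X`_j \in fat_ideal_part p m t
  -> forall j, c j = 0.
  move=> /fat_ideal_partP cI j; have /rowP/(_ j) : \row_j c j = 0.
    apply: indw => l; apply: fat_ideal_affm.
    suff -> : \sum_j0 (\row_j1 c j1) 0 j0 *: w j0
      = val (\sum_(j0 < N) c j0 *: X`_j0) by [].
    rewrite raddf_sum; apply: eq_bigr => k _; rewrite mxE.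
    by rewrite (nth_map k) ?size_enum_ord // nth_ord_enum.
  by rewrite !mxE.
have freeX : free X.
  by apply/freeP => c c0; apply: comb; rewrite c0 mem0v.
have <- : \dim <<X>> = N by rewrite (eqP freeX) size_tuple.
rewrite /hilb -dimv_disjoint_sum; last first.
  apply/eqP; rewrite -subv0; apply/subvP => x; rewrite memv_cap memv0.
  move=> /andP[xI /coord_span Dx]; apply/eqP; rewrite Dx big1 // => j _.
  by rewrite (comb (fun j => coord X j x)) ?scale0r // -Dx.
by rewrite -(dim_forms C) dimvS ?subvf.
Qed.

(** Each point imposes ['C(m + 1, 2)] linear conditions in the chart, and by Euler's formula the
    forms satisfying them all have multiplicity at least [m]. *)
Lemma hilb_lower (C : numClosedFieldType) (n m t : nat) (p : 'M[C]_(n, 3)) :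
  (forall l, p l ord0 != 0) ->
  ('C(t + 2, 2) <= hilb p m t + n * 'C(m + 1, 2))%N.
Proof.
move=> p0; pose q := size (jets m).
pose ev (F : dhomog 3 C t) : 'rV[C]_(n * q) := mxvec (\matrix_(l < n, i < q)
  ((val F)^`M[amon (jet (m := m) i).1 (jet i).2]).@[p l]).
have ev_lin : linear ev.
  move=> a F G; apply/rowP => k; case/mxvec_indexP: k => l i.
  by rewrite !mxE !mxvecE !mxE linearP mevalD mevalZ.
pose evL := GRing.isLinear.Build _ _ _ _ ev ev_lin.
pose f := linfun (HB.pack_for {linear dhomog 3 C t -> 'rV[C]_(n * q)} ev evL).
have kerI : (lker f <= fat_ideal_part p m t)%VS.
  apply/subvP => F; rewrite memv_ker lfunE /= => /eqP/rowP evF.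
  apply/fat_ideal_partP; exists [:: (1, val F)]; split; last first.
    by rewrite big_seq1 mul1r.
  move=> c; rewrite inE => /eqP -> /=; split; first by exists t; apply: valP.
  move=> l; apply: (affm_mult_ge (p0 l) (mpoly_euler (valP F))).
  apply/affm_jets => i; have := evF (mxvec_index l i).
  by rewrite mxvecE !mxE.
rewrite -(dim_forms C) -(limg_ker_dim f fullv) capfv leq_add ?dimvS //.
rewrite -size_jets; apply: leq_trans (dimvS (subvf _)) _.
by rewrite dimvf /dim /= mul1n.
Qed.

Lemma hilb_eq0_le (C : numClosedFieldType) (n m t t' : nat) (p : 'M[C]_(n, 3)) :
  (t <= t')%N -> hilb p m t' = 0%N -> hilb p m t = 0%N.
Proof.
move=> le_tt' /eqP; rewrite /hilb !dimv_eq0 => /eqP I0.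
apply/eqP; rewrite dimv_eq0 -subv0; apply/subvP => F /fat_ideal_partP IF.
have hF : 'X_ord0 ^+ (t' - t) * val F \is t'.-homog.
  by have := dhomogM (mpolyX_homog1 C (t' - t) ord0) (valP F); rewrite subnK.
have : DHomog hF \in fat_ideal_part p m t'.
  apply/fat_ideal_partP => /=.
  rewrite -[X in fat_ideal p m X]addr0; apply: ideal_generated_comb => //.
  by exists [::]; split=> //; rewrite big_nil.
rewrite I0 !memv0 => /eqP/(congr1 val)/= /eqP; rewrite mulf_eq0 expf_eq0.
by rewrite -msupp_eq0 msuppX andbF /=.
Qed.

(** * Choice of the monomials *)

Lemma sum_minn_sub (r Q K : nat) :
  (\sum_(k < K) minn r (Q - k * r) = minn Q (K * r))%N.
Proof.
elim: K => [|K IHK]; first by rewrite big_ord0 minn0.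
by rewrite big_ord_recr /= IHK mulSn; lia.
Qed.

(* The sum is the difference of the colengths of the ideals [v >= Q] and
   [v >= Q - r], so that it telescopes over the levels. *)
Lemma sum_minn_le (n r m : nat) : (r <= n)%N ->
  forall b a Q, (Q <= a + n * b)%N ->
  (\sum_(b' < m) minn r (Q - n * b') <= a + r * b)%N.
Proof.
move=> le_rn; elim: m => [|m IHm] b a Q leQ; first by rewrite big_ord0.
rewrite big_ord_recl muln0 subn0.
rewrite (eq_bigr (fun b' : 'I_m => minn r (Q - n - n * b')))%N; last first.
  by move=> b' _; rewrite /= /bump /= add1n mulnS subnDA.
case: b leQ => [|b] leQ.
  have := IHm 0%N (Q - n)%N (Q - n)%N (leq_addr _ _).
  move: leQ; rewrite !muln0 !addn0; move: (\sum_(_ < m) _)%N => S leQ leS.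
  lia.
have leQ' : (Q - n <= a + n * b)%N by move: leQ; rewrite mulnS; lia.
have := IHm b a (Q - n)%N leQ'; rewrite mulnS.
by move: (\sum_(_ < m) _)%N => S leS; lia.
Qed.

Lemma sum_ord_mul (f : nat -> nat) (d K : nat) :
  (\sum_(k < K) \sum_(a < d) f (k * d + a) = \sum_(x < K * d) f x)%N.
Proof.
elim: K => [|K IHK]; first by rewrite !big_ord0.
by rewrite big_ord_recr /= IHK mulSnr big_split_ord.
Qed.

Lemma sum_ord_sub_ge (T x : nat) : (T <= x)%N ->
  (\sum_(a < x) (T - a) = 'C(T + 1, 2))%N.
Proof.
move=> /subnKC <-; rewrite big_split_ord /= sum_ord_sub big1 ?addn0 // => a _.
by rewrite subnDA subnn.
Qed.

(** Triples are encoded as in [xyu]; truncated subtraction leaves no [b] when [k d + a > t]. *)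
Definition level (d t k : nat) : seq (nat * (nat * nat)) :=
  [seq (k, (a, b)) | a <- iota 0 d, b <- iota 0 (t.+1 - (k * d + a))].

Lemma size_level (d t k : nat) :
  size (level d t k) = (\sum_(a < d) (t.+1 - (k * d + a)))%N.
Proof.
rewrite size_allpairs_dep sumnE big_map.
rewrite -(big_mkord xpredT (fun a => t.+1 - (k * d + a))%N) /index_iota subn0.
by apply: eq_bigr => a _; rewrite size_iota.
Qed.

Lemma mem_level (d t k : nat) (z : nat * (nat * nat)) :
  z \in level d t k ->
  [/\ z.1 = k, z.2.1 < d & z.2.1 + z.2.2 + z.1 * d <= t]%N.
Proof.
case/allpairsPdep => a [b []]; rewrite !mem_iota => lta ltb -> /=.
by split=> //; lia.
Qed.

Lemma uniq_level (d t k : nat) : uniq (level d t k).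
Proof.
apply: allpairs_uniq_dep => [|a _|]; try exact: iota_uniq.
by move=> [a b] [a' b'] _ _ [-> ->].
Qed.

(** Independence depends only on how many elements each level contributes, so the first [e k] are
    taken. *)
Fixpoint select (d t : nat) (e : nat -> nat) (K : nat) :
    seq (nat * (nat * nat)) :=
  if K is K'.+1 then select d t e K' ++ take (e K') (level d t K') else [::].

Lemma mem_select (d t : nat) (e : nat -> nat) (K : nat) (z : nat * (nat * nat))
  :
  z \in select d t e K ->
  [/\ z.1 < K, z.2.1 < d & z.2.1 + z.2.2 + z.1 * d <= t]%N.
Proof.
elim: K => [//|K IHK] /=; rewrite mem_cat => /orP[/IHK[lt_zK ? ?]|].
  by split=> //; apply: ltnW.
by move=> /mem_take/mem_level[-> ? ?]; split.
Qed.

Lemma uniq_select (d t : nat) (e : nat -> nat) (K : nat) : uniq (select d t e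
  K).
Proof.
elim: K => [//|K IHK] /=; rewrite cat_uniq IHK take_uniq ?uniq_level // andbT
  /=.
apply/hasPn => z /mem_take/mem_level[Ez _ _]; apply/negP => /mem_select[].
by rewrite Ez ltnn.
Qed.

Lemma count_select (d t : nat) (e : nat -> nat) (K k : nat) :
  (count [pred z | z.1 == k] (select d t e K) <= e k)%N.
Proof.
elim: K => [//|K IHK] /=; rewrite count_cat.
have [Kk|Kk] := eqVneq K k; last first.
  rewrite [X in (_ + X)%N](_ : _ = 0%N) ?addn0 //.
  apply/eqP; rewrite -leqn0 leqNgt -has_count; apply/hasPn => z.
  by move=> /mem_take/mem_level[Ez _ _] /=; rewrite Ez.
rewrite [X in (X + _)%N](_ : _ = 0%N) ?add0n; last first.
  apply/eqP; rewrite -leqn0 leqNgt -has_count; apply/hasPn => z.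
  by move=> /mem_select[lt_zK _ _] /=; rewrite -Kk neq_ltn lt_zK.
apply: leq_trans (count_size _ _) _; rewrite size_take Kk; case: ltnP => //.
Qed.

Lemma size_select (d t : nat) (e : nat -> nat) (K : nat) :
  (forall k, (k < K)%N -> (e k <= size (level d t k))%N) ->
  size (select d t e K) = (\sum_(k < K) e k)%N.
Proof.
elim: K => [|K IHK] le_e; first by rewrite big_ord0.
rewrite big_ord_recr /= size_cat IHK => [|k lt_kK]; last exact/le_e/ltnW.
by rewrite size_takel ?le_e.
Qed.

Lemma select_indep (F : numFieldType) (d n r m t K : nat) (e : nat -> nat) :
  (r <= n)%N -> (forall k a b, k < K -> n * m <= a + n * b + k * r ->
     e k <= a + r * b)%N ->
  exists2 g : {poly F}, g != 0 & forall x, x != 0 -> g.[x] != 0 ->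
    indep_mult m (config (curve_graph F d r) n x)
      (fun j => curve_form F d t (tnth (in_tuple (select d t e K)) j)).
Proof.
move=> le_rn le_e; apply: (@config_indep F d n r m t K) => //;
  first exact: uniq_select.
  by move=> z /mem_select[].
move=> k a b lt_kK leQ; apply: leq_trans (count_select _ _ _ _ _) _.
exact: le_e.
Qed.

Lemma select_homog (F : comNzRingType) (d t K : nat) (e : nat -> nat) j :
  (0 < d)%N ->
  curve_form F d t (tnth (in_tuple (select d t e K)) j) \is t.-homog.
Proof.
move=> d0; apply: curve_form_homog => //.
by have /mem_select[] := mem_tnth j (in_tuple (select d t e K)).
Qed.

Lemma poly_nonroot (F : numFieldType) (p : {poly F}) :
  p != 0 -> exists x, p.[x] != 0.
Proof.
move=> p0; apply: contrapT => noroot.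
pose s : seq F := [seq i%:R | i <- iota 0 (size p)].
have : (size s < size p)%N.
  apply: max_poly_roots p0 _ _.
    apply/allP => x _; apply: contrapT => /negP px; apply: noroot.
    by exists x.
  by rewrite map_inj_uniq ?iota_uniq // => i j /eqP; rewrite eqr_nat => /eqP.
by rewrite size_map size_iota ltnn.
Qed.

(** The dimension of the degree [t] part of the coordinate ring of a plane curve of degree [d]. *)
Definition level_count (d t : nat) : nat := (\sum_(a < d) (t.+1 - a))%N.

(** Each of the [d] values of [a] gains at most [u d] values of [b], and exactly that many unless
    [s + 1 - a] is truncated. *)
Lemma size_level_shift (d s k u : nat) :
  (size (level d ((k + u) * d + s) k) <= u * d ^ 2 + level_count d s)%N.
Proof.
rewrite size_level /level_count.
have -> : (u * d ^ 2 = \sum_(a < d) u * d)%N.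
  by rewrite sum_nat_const card_ord mulnCA.
rewrite -big_split /=.
by apply: leq_sum => a _; rewrite mulnDl; lia.
Qed.

Lemma size_level_shift_eq (d s k u : nat) : (d <= s.+2)%N ->
  size (level d ((k + u) * d + s) k) = (u * d ^ 2 + level_count d s)%N.
Proof.
move=> le_ds; rewrite size_level /level_count.
have -> : (u * d ^ 2 = \sum_(a < d) u * d)%N.
  by rewrite sum_nat_const card_ord mulnCA.
rewrite -big_split /=.
by apply: eq_bigr => a _; have := ltn_ord a; rewrite mulnDl; lia.
Qed.

Lemma level_count_lt (d s : nat) : (s < d)%N -> level_count d s = 'C(s + 2, 2).
Proof. by move=> lt_sd; rewrite /level_count sum_ord_sub_ge // addn2 addn1. Qed.

(** Among the monomials of degree at most [d], the condition [a < d] excludes only [x^d]. *)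
Lemma level_count_diag (d : nat) : (level_count d d).+1 = 'C(d + 2, 2).
Proof.
rewrite addn2 -[d.+2]addn1 -sum_ord_sub big_ord_recr /= subSnn addn1.
by [].
Qed.

(** Put [r = d^2 + eps], [u = m + i - k] and [N = level_count d s]; the level has at most
    [u d^2 + N] elements. The first hypothesis gives [a + (r + eps) b >= N + u r], which suffices if
    [b <= u]. If [b > u], then [r b >= u d^2 + d^2] suffices as [N <= d^2]. *)
Lemma alpha_count (d eps i s m : nat) :
  (i * (d ^ 2 + eps) + level_count d s <= eps * m)%N ->
  (level_count d s <= d ^ 2)%N ->
  forall k a b, (k < (m + i).+1)%N ->
    ((d ^ 2 + 2 * eps) * m
      <= a + (d ^ 2 + 2 * eps) * b + k * (d ^ 2 + eps))%N ->
    (size (level d ((m + i) * d + s) k) <= a + (d ^ 2 + eps) * b)%N.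
Proof.
move=> lo le_N k a b; rewrite ltnS => /subnKC; set u := (m + i - k)%N => Dk leQ.
rewrite -Dk; apply: leq_trans (size_level_shift _ _ _ _) _.
set D := (d ^ 2)%N in leQ lo le_N *; set N := level_count d s in lo le_N *.
have [le_bu | lt_ub] := leqP b u; last first.
  have := leq_mul (leqnn (D + eps)) lt_ub; nia.
have e1 := leq_mul (leqnn eps) le_bu.
have e2 : (k * (D + eps) + u * (D + eps) = (m + i) * (D + eps))%N.
  by rewrite -mulnDl Dk.
nia.
Qed.

(** With [u = m + i - k] and [n = d^2 + 2 eps], [sum_minn_le] is applied at [b = u - i], truncated,
    and [a = Q - n b]. For [u >= i] it bounds the sum by [eps m + (u - i) d^2], for [u < i] by [Q]
    itself; both are at most the size [u d^2 + level_count d s]. *)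
Lemma tau_count (d eps i s m : nat) :
  (d <= s.+2)%N ->
  (eps * m <= i * d ^ 2 + level_count d s)%N ->
  forall k, (k < (m + i).+1)%N ->
  (\sum_(b < m) minn (d ^ 2 + eps)
      ((d ^ 2 + 2 * eps) * m - k * (d ^ 2 + eps) - (d ^ 2 + 2 * eps) * b)
    <= size (level d ((m + i) * d + s) k))%N.
Proof.
move=> le_ds hi k; rewrite ltnS => /subnKC; set u := (m + i - k)%N => Dk.
rewrite -[in X in (_ <= X)%N]Dk size_level_shift_eq //.
set D := (d ^ 2)%N in hi *; set N := level_count d s in hi *.
set Q := (_ * m - _)%N.
have le_rn : (D + eps <= D + 2 * eps)%N by lia.
apply: leq_trans (sum_minn_le m le_rn (b := u - i)
  (a := Q - (D + 2 * eps) * (u - i)) (Q := Q) _) _; first lia.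
have e2 : (k * (D + eps) + u * (D + eps) = (m + i) * (D + eps))%N.
  by rewrite -mulnDl Dk.
have [le_iu | lt_ui] := leqP i u.
  have [v Dv] : exists v, u = (i + v)%N by exists (u - i)%N; rewrite subnKC.
  rewrite Dv addKn; rewrite Dv in e2 Dk.
  have e3 : (v <= m)%N by lia.
  have e4 := leq_mul (leqnn eps) e3.
  rewrite /Q; nia.
rewrite (_ : u - i = 0)%N ?muln0 ?addn0; last by lia.
have e4 := leq_mul (leqnn eps) (ltnW lt_ui).
rewrite /Q; nia.
Qed.

(** * Arithmetic of the ranges of m *)

Lemma double_bin2 (x : nat) : (2 * 'C(x + 2, 2) = (x + 2) * (x + 1))%N.
Proof. by rewrite -mul_bin_diag addn2 bin1 addn1. Qed.

(* Range (a) is cut into three pieces, which are the ranges (b), (c) and (d)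
   for [i = 0]. *)
Lemma mult_range (d eps i m : nat) (hd : (3 <= d)%N) (heps : (0 < eps)%N)
    (hm :
      [\/ (d%:R - 1) * (d%:R - 2) / (2 * eps%:R) <= m%:R :> rat
            /\ m%:R < (d%:R + 2) * (d%:R + 1) / (2 * eps%:R) :> rat,
          (i%:R * (d%:R ^+ 2 + eps%:R) + (d%:R - 1) * (d%:R - 2) / 2) / eps%:R
              <= m%:R :> rat
            /\ m%:R <= (i%:R * d%:R ^+ 2 + d%:R * (d%:R - 1) / 2) / eps%:R
                 :> rat,
          (i%:R * (d%:R ^+ 2 + eps%:R) + d%:R * (d%:R - 1) / 2) / eps%:R
              <= m%:R :> rat
            /\ m%:R <= (i%:R * d%:R ^+ 2 + (d%:R + 1) * d%:R / 2) / eps%:R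
                 :> rat
        | (i%:R * (d%:R ^+ 2 + eps%:R) + (d%:R + 1) * d%:R / 2) / eps%:R
              <= m%:R :> rat
            /\ m%:R <= (i%:R * d%:R ^+ 2 + d%:R * (d%:R + 3) / 2) / eps%:R
                 :> rat]) :
  exists j s, [/\ (d <= s.+3)%N, (s < d)%N,
    (j * (d ^ 2 + eps) + level_count d s <= eps * m)%N &
    (eps * m <= j * d ^ 2 + level_count d s.+1)%N].
Proof.
(* With [d = e + 3], the values [s = e + k] for [k < 3] are [d - 3], [d - 2] and [d - 1]. *)
have [e Ed] : exists e, d = e.+3 by exists (d - 3)%N; lia.
have Es k : (k < 3)%N -> level_count d (e + k) = 'C(e + k + 2, 2).
  by move=> k3; rewrite level_count_lt //; lia.
have N0 := Es 0%N isT; have N1 := Es 1%N isT; have N2 := Es 2%N isT.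
have N3 : (level_count d (e + 3)).+1 = 'C(e + 3 + 2, 2).
  by rewrite -level_count_diag Ed addn3.
have B0 := double_bin2 (e + 0); have B1 := double_bin2 (e + 1).
have B2 := double_bin2 (e + 2); have B3 := double_bin2 (e + 3).
have ER : d%:R = e%:R + 3 :> rat by rewrite Ed -addn3 natrD.
have eps0 : 0 < eps%:R :> rat by rewrite ltr0n.
have eps2 : 0 < 2 * eps%:R :> rat by rewrite mulr_gt0.
have to_nat (x y : nat) : (x%:R <= y%:R :> rat) -> (x <= y)%N by rewrite
  ler_nat.
have to_natlt (x y : nat) : (x%:R < y%:R :> rat) -> (x < y)%N by rewrite
  ltr_nat.
have fin j k : (k < 3)%N ->
    (2 * (j * (d ^ 2 + eps)) + (e + k + 2) * (e + k + 1) <= 2 * (eps * m))%N ->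
    (eps * m <= j * d ^ 2 + level_count d (e + k.+1))%N ->
  exists j s, [/\ (d <= s.+3)%N, (s < d)%N,
    (j * (d ^ 2 + eps) + level_count d s <= eps * m)%N &
    (eps * m <= j * d ^ 2 + level_count d s.+1)%N].
  move=> k3 lo hi; exists j, (e + k)%N; split; try lia; last by rewrite -addnS.
  by rewrite Es //; have := double_bin2 (e + k); lia.
case: hm => -[].
- rewrite ler_pdivrMr // ltr_pdivlMr // ER => lo hi.
  have lo' : ((e + 2) * (e + 1) <= 2 * (eps * m))%N.
    by apply: to_nat; rewrite !natrM !natrD; lra.
  have hi' : (2 * (eps * m) < (e + 5) * (e + 4))%N.
    by apply: to_natlt; rewrite !natrM !natrD; lra.
  have [le1|lt1] := leqP (eps * m) (level_count d (e + 1)).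
    by apply: (fin 0%N 0%N) => //; rewrite ?mul0n ?muln0 ?addn0.
  have [le2|lt2] := leqP (eps * m) (level_count d (e + 2)).
    by apply: (fin 0%N 1%N) => //; rewrite ?mul0n ?muln0 ?add0n -?B1; lia.
  (* The strict bound [eps m < 'C(d + 2, 2)] means [eps m <= level_count d d], which is one less
     than the binomial. *)
  by apply: (fin 0%N 2%N) => //; rewrite ?mul0n ?muln0 ?add0n -?B2; lia.
- rewrite ler_pdivrMr // ler_pdivlMr // => lo hi.
  apply: (fin i 0%N) => //.
    by apply: to_nat; rewrite !(natrM, natrD, natrX); rewrite ER in lo *; lra.
  have : (2 * (eps * m) <= 2 * (i * d ^ 2) + (e + 3) * (e + 2))%N.
    by apply: to_nat; rewrite !(natrM, natrD, natrX); rewrite ER in hi *; lra.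
  by rewrite N1; lia.
- rewrite ler_pdivrMr // ler_pdivlMr // => lo hi.
  apply: (fin i 1%N) => //.
    by apply: to_nat; rewrite !(natrM, natrD, natrX); rewrite ER in lo *; lra.
  have : (2 * (eps * m) <= 2 * (i * d ^ 2) + (e + 4) * (e + 3))%N.
    by apply: to_nat; rewrite !(natrM, natrD, natrX); rewrite ER in hi *; lra.
  by rewrite N2; lia.
rewrite ler_pdivrMr // ler_pdivlMr // => lo hi.
apply: (fin i 2%N) => //.
  by apply: to_nat; rewrite !(natrM, natrD, natrX); rewrite ER in lo *; lra.
(* Here [d (d + 3) / 2 = 'C(d + 2, 2) - 1] is [level_count d d]. *)
have : (2 * (eps * m) <= 2 * (i * d ^ 2) + (e + 3) * (e + 6))%N.
  by apply: to_nat; rewrite !(natrM, natrD, natrX); rewrite ER in hi *; lra.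
by lia.
Qed.

(** The family [w1] has as many elements as the space of forms of degree [t1], so the ideal is 0 up
    to that degree. From degree [t1 + 1] on, [w2] shows that the conditions are independent.
    [N1 <= N2] makes the maximum 0 in the low degrees. *)
Lemma hilb_of_indep (C : numClosedFieldType) (n m t1 N1 N2 : nat)
    (p : 'M[C]_(n, 3)) (w1 : 'I_N1 -> {mpoly C[3]})
    (w2 : 'I_N2 -> {mpoly C[3]}) :
  (forall l, p l ord0 != 0) ->
  N1 = 'C(t1 + 2, 2) -> N2 = (n * 'C(m + 1, 2))%N -> (N1 <= N2)%N ->
  (forall j, w1 j \is t1.-homog) -> (forall j, w2 j \is t1.+1.-homog) ->
  indep_mult m p w1 -> indep_mult m p w2 ->
  forall t, (hilb p m t)%:Z
        = Num.max 0 ('C(t + 2, 2)%:Z - n%:Z * 'C(m + 1, 2)%:Z).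
Proof.
move=> p0 EN1 EN2 le_N hw1 hw2 ind1 ind2 t; have [le_tt1 | lt_t1t] := leqP t t1.
  have h0 : hilb p m t1 = 0%N by have := hilb_upper hw1 ind1; lia.
  rewrite (hilb_eq0_le le_tt1 h0).
  have : ('C(t + 2, 2) <= 'C(t1 + 2, 2))%N by rewrite leq_bin2l // leq_add2r.
  by lia.
have hw j : 'X_ord0 ^+ (t - t1.+1) * w2 j \is t.-homog.
  by have := dhomogM (mpolyX_homog1 C (t - t1.+1) ord0) (hw2 j); rewrite subnK.
have := hilb_upper hw (indep_mulX0 (k := t - t1.+1) p0 ind2).
by have := hilb_lower m t p0; lia.
Qed.

Lemma size_select_alpha (d t K : nat) : (t < K * d)%N ->
  size (select d t (fun k => size (level d t k)) K) = 'C(t + 2, 2).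
Proof.
move=> lt_tK; rewrite size_select // addn2 -[t.+2]addn1.
under eq_bigr => k _ do rewrite size_level.
by rewrite (sum_ord_mul (fun x => t.+1 - x)%N) sum_ord_sub_ge.
Qed.

(** For fixed [b] the sum over the levels cuts [n (m - b)] into pieces of length at most [r]. *)
Lemma sum_tau (n r m K : nat) : (n * m <= K * r)%N ->
  (\sum_(k < K) \sum_(b < m) minn r (n * m - k * r - n * b)
    = n * 'C(m + 1, 2))%N.
Proof.
move=> le_K; rewrite exchange_big -sum_ord_sub big_distrr /=.
apply: eq_bigr => b _; rewrite mulnBr.
rewrite (eq_bigr (fun k : 'I_K => minn r (n * m - n * b - k * r)))%N.
  by rewrite sum_minn_sub; apply/minn_idPl; lia.
by move=> k _; rewrite subnAC.
Qed.

Theorem mainTheorem4 (R : realType) (d eps i n m : nat)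
    (hd : (3 <= d)%N) (heps : (0 < eps)%N) (hi : (0 < i)%N)
    (hn : n = (d ^ 2 + 2 * eps)%N)
    (hm :
      [\/ (d%:R - 1) * (d%:R - 2) / (2 * eps%:R) <= m%:R :> rat
            /\ m%:R < (d%:R + 2) * (d%:R + 1) / (2 * eps%:R) :> rat,
          (i%:R * (d%:R ^+ 2 + eps%:R) + (d%:R - 1) * (d%:R - 2) / 2) / eps%:R
              <= m%:R :> rat
            /\ m%:R <= (i%:R * d%:R ^+ 2 + d%:R * (d%:R - 1) / 2) / eps%:R
                 :> rat,
          (i%:R * (d%:R ^+ 2 + eps%:R) + d%:R * (d%:R - 1) / 2) / eps%:R
              <= m%:R :> rat
            /\ m%:R <= (i%:R * d%:R ^+ 2 + (d%:R + 1) * d%:R / 2) / eps%:R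
                 :> rat
        | (i%:R * (d%:R ^+ 2 + eps%:R) + (d%:R + 1) * d%:R / 2) / eps%:R
              <= m%:R :> rat
            /\ m%:R <= (i%:R * d%:R ^+ 2 + d%:R * (d%:R + 3) / 2) / eps%:R
                 :> rat]) :
  for_general_points (fun p : 'M[R[i]]_(n, 3) =>
    forall t : nat,
      (hilb p m t)%:Z
        = Num.max 0 ('C(t + 2, 2)%:Z - n%:Z * 'C(m + 1, 2)%:Z)).
Proof.
have [j [s [le_ds lt_sd lo up]]] := mult_range hd heps hm.
have d0 : (0 < d)%N by lia.
(* In the extreme case [s + 1 = d] this is [d (d + 3) / 2 <= d^2], which holds from [d = 3] on. *)
have le_Nd : (level_count d s.+1 <= d ^ 2)%N.
  have [lt_s1|] := ltnP s.+1 d.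
    by rewrite level_count_lt //; have := double_bin2 s.+1;
      rewrite expnS expn1; nia.
  move=> le_ds1; have -> : s.+1 = d by lia.
  by have := level_count_diag d; have := double_bin2 d; rewrite expnS expn1;
    nia.
have le_N : (level_count d s <= level_count d s.+1)%N.
  by apply: leq_sum => a _; apply: leq_sub2r.
pose r := (d ^ 2 + eps)%N; pose K := (m + j).+1.
have le_rn : (r <= n)%N by rewrite /r hn; lia.
pose t1 := ((m + j) * d + s)%N; pose t2 := ((m + j) * d + s.+1)%N.
have Et2 : t2 = t1.+1 by rewrite /t2 /t1 addnS.
pose e1 k := size (level d t1 k).
pose e2 k := (\sum_(b < m) minn r (n * m - k * r - n * b))%N.
pose s1 := select d t1 e1 K; pose s2 := select d t2 e2 K.
pose w1 k := curve_form R[i] d t1 (tnth (in_tuple s1) k).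
pose w2 k := curve_form R[i] d t2 (tnth (in_tuple s2) k).
have hw1 k : w1 k \is t1.-homog by apply: select_homog.
have hw2 k : w2 k \is t1.+1.-homog by rewrite -Et2; apply: select_homog.
have sz1 : size s1 = 'C(t1 + 2, 2).
  by apply: size_select_alpha; rewrite /t1 /K mulSn; lia.
have sz2 : size s2 = (n * 'C(m + 1, 2))%N.
  rewrite size_select => [|k lt_kK].
    (* [n m <= K r] amounts to [eps m <= (j + 1) r], and [eps m <= j d^2 + d^2]. *)
    by apply: sum_tau; rewrite /K /r hn; nia.
  by rewrite /e2 /r hn; apply: tau_count.
have H1 k a b : (k < K)%N -> (n * m <= a + n * b + k * r)%N ->
    (e1 k <= a + r * b)%N.
  by rewrite /e1 /r hn; apply: alpha_count => //; apply: leq_trans le_Nd.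
have H2 k a b : (k < K)%N -> (n * m <= a + n * b + k * r)%N ->
    (e2 k <= a + r * b)%N.
  by move=> _ leQ; apply: sum_minn_le => //; lia.
have [g1 g10 ind1] := @select_indep R[i] d n r m t1 K e1 le_rn H1.
have [g2 g20 ind2] := @select_indep R[i] d n r m t2 K e2 le_rn H2.
have [x] : exists x, ('X * (g1 * g2)).[x] != 0.
  by apply: poly_nonroot; rewrite !mulf_neq0 ?polyX_eq0.
rewrite !hornerM hornerX !mulf_eq0 !negb_or => /and3P[x0 g1x g2x].
pose p0 := config (curve_graph R[i] d r) n x.
have p00 l : p0 l ord0 = 1 by rewrite mxE.
(* [le_12] says that the forms of degree [t1] are at most as numerous as the conditions. *)
have [le_12 [f1 [G1 [mG1 G1p0 G1P]]]] := indep_open hw1 (ind1 x x0 g1x).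
have [_ [f2 [G2 [mG2 G2p0 G2P]]]] := indep_open hw2 (ind2 x x0 g2x).
(* Its nonvanishing puts all the points in the chart [X_0 != 0]. *)
pose GX : {mpoly R[i][n * 3]} := \prod_(l < n) at_point l 'X_ord0.
have GXE (p : 'M[R[i]]_(n, 3)) : GX.@[mxvec p 0] = \prod_l p l ord0.
  by rewrite rmorph_prod; apply: eq_bigr => l _;
    rewrite /= at_point_eval mevalXU.
have mGX : multihomogeneous GX.
  have hX : ('X_ord0 : {mpoly R[i][3]}) \is 1.-homog by apply: mpolyX_homog1
    1%N _.
  eexists; exact: (@multidegree_prod _ _ _ (index_enum 'I_n) _ _
    (fun l => at_point_multidegree (l := l) hX)).
exists (fun p => (G1 * (G2 * GX)).@[mxvec p 0] != 0); split.
- exists (fun G => G = G1 * (G2 * GX)); split=> [_ ->|p _].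
    case: mGX => fX mGX; eexists.
    exact: (multidegreeM mG1 (multidegreeM mG2 mGX)).
  by split=> [nz|[_ ->] //]; exists (G1 * (G2 * GX)).
- exists p0.
    move=> l; apply/eqP => /rowP/(_ ord0)/eqP.
    by rewrite mxE p00 mxE oner_eq0.
  rewrite !mevalM !mulf_neq0 // GXE big1 ?oner_neq0 // => l _; exact: p00.
move=> p _; rewrite !mevalM !mulf_eq0 !negb_or GXE => /and3P[nz1 nz2 nzX].
apply: (hilb_of_indep _ sz1 sz2 _ hw1 hw2 (G1P p nz1) (G2P p nz2)).
  by move=> l; have /prodf_neq0 := nzX; apply.
by rewrite sz2 [X in (X <= _)%N]sz1 in le_12 *.
Qed.
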